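(* Let $J\in\mathbb{R}^{3\times 3}$ be a constant symmetric matrix with $J_m I\preceq J\preceq J_M I$ for known constants $J_M\ge J_m>0$, and let $\omega_M>0$ be a known constant. Consider any trajectory $(R,\omega)$, defined for $t\ge 0$, of the rigid-body system $$\dot R=R\,\omega_\times,\qquad J\dot\omega=(J\omega)\times\omega+\tau,\qquad R(t)\in \mathrm{SO}(3),\ \omega(t)\in\mathbb{R}^3,$$ with known input torque $\tau(t)\in\mathbb{R}^3$, such that $|\omega(t)|\le\omega_M$ for all $t\ge 0$. Let $r_1(t)^T,r_2(t)^T$ be the first two rows of $R(t)$, so that $r_1,r_2$ are orthonormal and $\dot r_i=r_i\times\omega$ for $i=1,2$. The vectors $r_1,r_2$ are the measured outputs. Let $k_1,k_2>0$ be constants and let $l_1,l_2:\mathbb{R}^3\to\mathbb{R}$ be continuous functions such that the following gain conditions hold: along the trajectory, $$-k_1 r_{1\times}^2-k_2 r_{2\times}^2\succ J_M\left(\omega_M+\tfrac32\right)I,$$ and, for all $\hat\omega\in\mathbb{R}^3$ and $i=1,2$, $$l_i(\hat\omega)>(|\hat\omega|+\omega_M)\left(1+\frac{k_i}{J_m}\left(1+\frac{2k_i}{J_m}\right)\right).$$ Then the dynamical system with state $(\xi,\hat r_1,\hat r_2)\in\mathbb{R}^3\times\mathbb{R}^3\times\mathbb{R}^3$ given by $$\begin{aligned} \dot\xi={}&-k_1J^{-1}\left(r_{1\times}\hat r_{1\times}-\hat r_{1\times}r_{1\times}\right)\hat\omega-k_2J^{-1}\left(r_{2\times}\hat r_{2\times}-\hat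 r_{2\times}r_{2\times}\right)\hat\omega\\ &+l_1(\hat\omega)k_1J^{-1}\,r_1\times(\hat r_1-r_1)+l_2(\hat\omega)k_2J^{-1}\,r_2\times(\hat r_2-r_2)\\ &+J^{-1}\left((J\hat\omega)\times\hat\omega+\tau\right),\\ \hat\omega:={}&\xi-k_1J^{-1}(\hat r_1\times r_1)-k_2J^{-1}(\hat r_2\times r_2),\\ \dot{\hat r}_1={}&\hat r_1\times\hat\omega-l_1(\hat\omega)(\hat r_1-r_1),\\ \dot{\hat r}_2={}&\hat r_2\times\hat\omega-l_2(\hat\omega)(\hat r_2-r_2) \end{aligned}$$ is a uniformly global exponential observer for the rigid-body system, with angular velocity estimate $\hat\omega$.
   Context: For $a\in\mathbb{R}^3$, $a_\times$ denotes the skew-symmetric $3\times3$ matrix with $a_\times x=a\times x$ for all $x\in\mathbb{R}^3$. $|\cdot|$ is the Euclidean norm. For symmetric matrices, $A\succ B$ (respectively $A\succeq B$) means that $A-B$ is positive definite (respectively positive semidefinite). $I$ is the $3\times 3$ identity matrix. Estimation errors: $z:=\hat\omega-\omega$, $e_1:=\hat r_1-r_1$, $e_2:=\hat r_2-r_2$. ''Uniformly global exponential observer'' means that the zero estimation error is uniformly globally exponentially stable. That is, there exist constants $C,\lambda>0$, independent of the initial time, of the initial conditions of the system and of the observer, of the input $\tau$, and of the particular system trajectory satisfying $|\omega|\le\omega_M$, such that every observer solution, started from any initial condition $(\xi(t_0),\hat r_1(t_0),\hat r_2(t_0))\in\mathbb{R}^9$ at any $t_0\ge 0$, satisfies $$|(z(t),e_1(t),e_2(t))|\le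 C\,|(z(t_0),e_1(t_0),e_2(t_0))|\,e^{-\lambda(t-t_0)}\quad\text{for all } t\ge t_0.$$ *)

(* Defs.v *)
From HB Require Import structures.
From mathcomp Require Export all_boot all_order all_algebra.
From mathcomp Require Export all_classical all_reals all_analysis.
Export numFieldNormedType.Exports.
Export Order.TTheory GRing.Theory Num.Theory.

Set Implicit Arguments.
Unset Strict Implicit.
Unset Printing Implicit Defensive.

Local Open Scope classical_set_scope.
Local Open Scope ring_scope.

(* Indices live in 'I_3, where addition is modulo 3. *)
Definition cross (K : realType) (a b : 'cV[K]_3) : 'cV[K]_3 :=
  \col_i (a (i + 1) 0 * b (i + 2%:R) 0 - a (i + 2%:R) 0 * b (i + 1) 0).

Definition skew (K : realType) (a : 'cV[K]_3) : 'M[K]_3 :=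
  \matrix_(i, j) cross a (delta_mx j 0) i 0.

Lemma skewE (K : realType) (a x : 'cV[K]_3) : skew a *m x = cross a x.
Proof.
apply/colP => i; rewrite !mxE.
under eq_bigr => j _ do rewrite !mxE !eqxx !andbT mulrBl -!mulrA.
rewrite sumrB -!mulr_sumr.
have H (k : 'I_3) : \sum_j (k == j)%:R * x j 0 = x k 0.
  rewrite (bigD1 k) //= eqxx mul1r big1 ?addr0 // => j /negbTE jk.
  by rewrite eq_sym jk mul0r.
by rewrite !H.
Qed.

(* The norm that the library puts on matrices is the sup norm. *)
Definition enorm (K : realType) (n : nat) (v : 'cV[K]_n) : K :=
  Num.sqrt (\sum_i v i 0 ^+ 2).

Definition posdefmx (K : realType) (n : nat) (A : 'M[K]_n) : Prop :=
  forall x : 'cV[K]_n, x != 0 -> 0 < (x^T *m A *m x) 0 0.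

Definition possemidefmx (K : realType) (n : nat) (A : 'M[K]_n) : Prop :=
  forall x : 'cV[K]_n, 0 <= (x^T *m A *m x) 0 0.

Definition mx_gt (K : realType) (n : nat) (A B : 'M[K]_n) : Prop :=
  posdefmx (A - B).

Definition mx_ge (K : realType) (n : nat) (A B : 'M[K]_n) : Prop :=
  possemidefmx (A - B).

Definition SO (K : realType) (n : nat) (A : 'M[K]_n) : Prop :=
  A *m A^T = 1%:M /\ \det A = 1.

Definition time_dom (K : realType) (t0 : K) (T : \bar K) : set K :=
  [set t | t0 <= t /\ (t%:E < T)%E].

(* Derivative relative to the domain [D]: it is one-sided at an endpoint of
   an interval, and values of [f] outside [D] are irrelevant. *)
Definition has_deriv_within (K : realType) (V : normedModType K)
    (D : set K) (f : K -> V) (t : K) (df : V) : Prop :=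
  (s - t)^-1 *: (f s - f t) @[s --> within D (dnbhs t)] --> df.

(* Solutions of x' = F(t, x) on [t0, T[, where T may be +oo. *)
Definition solution (K : realType) (V : normedModType K)
    (F : K -> V -> V) (t0 : K) (T : \bar K) (x : K -> V) : Prop :=
  (t0%:E < T)%E /\
  forall t, time_dom t0 T t -> has_deriv_within (time_dom t0 T) x t (F t (x t)).

Definition maximal_solution (K : realType) (V : normedModType K)
    (F : K -> V -> V) (t0 : K) (T : \bar K) (x : K -> V) : Prop :=
  solution F t0 T x /\
  forall (T' : \bar K) (y : K -> V), solution F t0 T' y -> (T <= T')%E ->
    (forall t, time_dom t0 T t -> y t = x t) -> T' = T.

Section RigidBody.
Variables (K : realType) (J : 'M[K]_3).

Definition rigid_body_trajectory (Rot : K -> 'M[K]_3)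
    (omega tau : K -> 'cV[K]_3) : Prop :=
  let D := time_dom 0 +oo%E in
  forall t, 0 <= t ->
    [/\ SO (Rot t),
        has_deriv_within D Rot t (Rot t *m skew (omega t)) &
        exists domega : 'cV[K]_3,
          has_deriv_within D omega t domega /\
          J *m domega = cross (J *m omega t) (omega t) + tau t].

Definition row_vec (Rot : K -> 'M[K]_3) (i : 'I_3) (t : K) : 'cV[K]_3 :=
  (row i (Rot t))^T.

Variables (k1 k2 : K) (l1 l2 : 'cV[K]_3 -> K).

(* Observer states are triples (xi, rh1, rh2). *)
Definition obs_state : normedModType K :=
  ('cV[K]_3 * 'cV[K]_3 * 'cV[K]_3)%type.

Definition omega_hat (r1 r2 : 'cV[K]_3) (x : obs_state) : 'cV[K]_3 :=
  let: (xi, rh1, rh2) := x in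
  xi - k1 *: (invmx J *m cross rh1 r1) - k2 *: (invmx J *m cross rh2 r2).

Definition observer_field (r1 r2 tau : 'cV[K]_3) (x : obs_state) : obs_state :=
  let: (xi, rh1, rh2) := x in
  let wh := omega_hat r1 r2 x in
  (- (k1 *: (invmx J *m (skew r1 *m skew rh1 - skew rh1 *m skew r1) *m wh))
   - k2 *: (invmx J *m (skew r2 *m skew rh2 - skew rh2 *m skew r2) *m wh)
   + (l1 wh * k1) *: (invmx J *m cross r1 (rh1 - r1))
   + (l2 wh * k2) *: (invmx J *m cross r2 (rh2 - r2))
   + invmx J *m (cross (J *m wh) wh + tau),
   cross rh1 wh - l1 wh *: (rh1 - r1),
   cross rh2 wh - l2 wh *: (rh2 - r2)).

(* The estimation error (z, e1, e2) as a vector of K^9. *)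
Definition est_error (r1 r2 omega : 'cV[K]_3) (x : obs_state) :
    'cV[K]_(3 + (3 + 3)) :=
  let: (xi, rh1, rh2) := x in
  col_mx (omega_hat r1 r2 x - omega) (col_mx (rh1 - r1) (rh2 - r2)).

(* The trajectories considered are those satisfying [adm]. The error bound is
   required on the whole interval of existence of every observer solution, and
   solutions that cannot be continued are required to exist for all t >= t0. *)
Definition uniformly_global_exponential_observer
    (adm : (K -> 'M[K]_3) -> (K -> 'cV[K]_3) -> Prop) : Prop :=
  exists C lambda : K, [/\ 0 < C, 0 < lambda &
    forall (Rot : K -> 'M[K]_3) (omega tau : K -> 'cV[K]_3),
      rigid_body_trajectory Rot omega tau -> adm Rot omega ->
      let r1 := row_vec Rot 0 in
      let r2 := row_vec Rot 1 in
      let F := fun t => observer_field (r1 t) (r2 t) (tau t) in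
      let err := fun (x : K -> obs_state) t =>
        enorm (est_error (r1 t) (r2 t) (omega t) (x t)) in
      forall (t0 : K) (T : \bar K) (x : K -> obs_state), 0 <= t0 ->
        (solution F t0 T x -> forall t, time_dom t0 T t ->
           err x t <= C * err x t0 * expR (- lambda * (t - t0))) /\
        (maximal_solution F t0 T x -> T = +oo%E)].

End RigidBody.

(* Main.v *)
Require Import Defs.
From mathcomp Require Import ring lra.

(** In the error coordinates z = wh - w, e_i = rh_i - r_i the input torque
    cancels:
      J z' = sum_i k_i rh_i x (r_i x z) + (J wh) x wh - (J w) x w,
      e_i' = e_i x wh + r_i x z - l_i(wh) e_i.
    The term k_i z . (e_i x (r_i x z)) is cubic, so no quadratic function of
    the error decreases; the norm-like function
      Phi = sqrt (z . J z) + sqrt Jm / 2 * (|e_1| + |e_2|)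
    does, because |z|^2 |e_i| / sqrt (z . J z) <= |z| |e_i| / sqrt Jm,
    |z| <= s := |wh| + omegaM, and the gain l_i dominates multiples of s.
    It satisfies Phi' <= - lambda Phi with lambda = min (1/2) (omegaM/2); as it
    is not differentiable where a norm vanishes, each norm is first smoothed to
    sqrt (norm^2 + eps^2), and eps tends to 0 after Gronwall's lemma.

    A solution on a bounded interval therefore stays bounded and has a limit at
    the right endpoint.  The gains are merely continuous, so it is continued by
    Peano's theorem, applied to the error equation since tau need not be
    continuous. *)

Set Implicit Arguments.
Unset Strict Implicit.
Unset Printing Implicit Defensive.

Local Open Scope classical_set_scope.
Local Open Scope ring_scope.

(** * Derivatives relative to a set *)

(** The constants follow from the margins in the gain conditions. The gyroscopic term costs
    [JM * omegaM] times |z|^2, so the first condition leaves the rate 3/2 for sqrt (z . J z). Each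
    e_i' feeds |z| into Phi' with weight sqrt Jm / 2; together this is sqrt Jm |z| <= sqrt (z . J
    z), which uses up the rate 1 and leaves 1/2. The cubic terms are paid for by the gains l_i, of
    which at least s / 2 >= omegaM / 2 survives. Hence the two arguments of the minimum. Comparing
    Phi with the Euclidean norm on both sides gives C = 2 / sqrt Jm * (sqrt JM + sqrt Jm). Upper
    bounds of the gains along a solution are not uniform, but they occur only as factors of eps and
    vanish with it. Solutions are differentiable only relative to their interval, and nothing is
    assumed about continuity of their derivatives; the estimates therefore come from mean value
    arguments, never from integrals. *)

Section WithinDerivative.
Context {K : realType}.
Implicit Types (D : set K) (t : K).

(** Multiplying by [s - t] removes the quotient, and the inequality is trivial at [s = t], so the
    punctured neighbourhood disappears as well. Gluing and one-sided limits are handled in this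
    form. *)
Lemma has_deriv_withinP (V : normedModType K) D (f : K -> V) t d :
  has_deriv_within D f t d <->
  forall e, 0 < e -> exists2 r, 0 < r &
    forall s, D s -> `|s - t| < r -> `|f s - f t - (s - t) *: d| <= e * `|s - t|.
Proof.
split=> [/cvgrPdistC_le fd e e0|fd].
  have /nbhs_ballP[r /= r0 hr] := fd _ e0.
  exists r => // s Ds st.
  have [->|nst] := eqVneq s t.
    by rewrite !subrr scale0r subrr (@normr0 K K) mulr0 normr0.
  have st0 : s - t != 0 by rewrite subr_eq0.
  have bs : ball t r s by rewrite -ball_normE /ball_/= distrC.
  have := hr s bs nst Ds => /= h.
  have -> : f s - f t - (s - t) *: d
      = (s - t) *: ((s - t)^-1 *: (f s - f t) - d).
    by rewrite scalerBr scalerA mulfV // scale1r.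
  by rewrite normrZ mulrC ler_wpM2r.
apply/cvgrPdistC_le => e e0.
have [r r0 hr] := fd _ e0.
apply/nbhs_ballP; exists r => //= s bs nst Ds.
have st0 : s - t != 0 by rewrite subr_eq0.
have bst : `|s - t| < r by rewrite distrC; move: bs; rewrite -ball_normE.
have := hr s Ds bst.
have -> : f s - f t - (s - t) *: d
    = (s - t) *: ((s - t)^-1 *: (f s - f t) - d).
  by rewrite scalerBr scalerA mulfV // scale1r.
by rewrite normrZ mulrC ler_pM2r // normr_gt0.
Qed.

Lemma has_deriv_within_subset (V : normedModType K) D E (f : K -> V) t d :
  D `<=` E -> has_deriv_within E f t d -> has_deriv_within D f t d.
Proof.
move=> DE /has_deriv_withinP fd; apply/has_deriv_withinP => e /fd[r r0 hr].
by exists r => // s /DE; exact: hr.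
Qed.

Lemma eq_has_deriv_within (V : normedModType K) D (f : K -> V) t d d' :
  has_deriv_within D f t d -> d = d' -> has_deriv_within D f t d'.
Proof. by move=> fd <-. Qed.

(** Used to piece a continued solution together: away from the junction it agrees locally with one
    of its two parts. *)
Lemma has_deriv_within_local (V : normedModType K) D E (f g : K -> V) t d r :
  0 < r -> (forall s, D s -> `|s - t| < r -> E s /\ f s = g s) -> f t = g t ->
  has_deriv_within E f t d -> has_deriv_within D g t d.
Proof.
move=> r0 fg fgt /has_deriv_withinP fd; apply/has_deriv_withinP => e /fd[q q0 hq].
exists (Num.min r q); first by rewrite lt_min r0 q0.
move=> s Ds; rewrite lt_min => /andP[sr sq].
by have [Es <-] := fg s Ds sr; rewrite -fgt; exact: hq.
Qed.

Lemma has_deriv_within_continuous (V : normedModType K) D (f : K -> V) t d :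
  has_deriv_within D f t d -> f s @[s --> within D (nbhs t)] --> f t.
Proof.
move=> /has_deriv_withinP fd; apply/cvgrPdistC_le => e e0.
have [r r0 hr] := fd _ ltr01.
have c0 : 0 < 1 + `|d| by rewrite ltr_wpDr.
apply/nbhs_ballP; exists (Num.min r (e / (1 + `|d|))).
  by rewrite /= lt_min r0 divr_gt0.
move=> s; rewrite -ball_normE /= distrC lt_min => /andP[sr se] Ds.
have := hr s Ds sr; rewrite mul1r => h.
have -> : f s - f t = (f s - f t - (s - t) *: d) + (s - t) *: d by rewrite subrK.
apply: (le_trans (ler_normD _ _)); rewrite normrZ.
apply: (@le_trans _ _ (`|s - t| * (1 + `|d|))).
  by rewrite mulrDr mulr1 lerD2r.
by rewrite -ler_pdivlMr // ltW.
Qed.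

Lemma has_deriv_within_continuous_within (V : normedModType K) D (f : K -> V) df :
  (forall t, D t -> has_deriv_within D f t (df t)) -> {within D, continuous f}.
Proof.
move=> fd; apply/subspace_continuousP => t Dt.
exact: has_deriv_within_continuous (fd t Dt).
Qed.

Lemma has_deriv_within_cst (V : normedModType K) D (v : V) t :
  has_deriv_within D (fun=> v) t 0.
Proof.
apply/has_deriv_withinP => e e0; exists 1 => // s _ _.
by rewrite subrr sub0r normrN scaler0 normr0 mulr_ge0 // ltW.
Qed.

Lemma has_deriv_withinD (V : normedModType K) D (f g : K -> V) t df dg :
  has_deriv_within D f t df -> has_deriv_within D g t dg ->
  has_deriv_within D (fun s => f s + g s) t (df + dg).
Proof.
move=> fd gd; rewrite /has_deriv_within.
have -> : (fun s => (s - t)^-1 *: (f s + g s - (f t + g t))) =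
    (fun s => (s - t)^-1 *: (f s - f t)) + (fun s => (s - t)^-1 *: (g s - g t)).
  by apply: funext => s; rewrite opprD addrACA scalerDr.
exact: cvgD.
Qed.

Lemma has_deriv_within_linear (V W : normedModType K) D (L : V -> W) (f : K -> V)
    t df :
  {morph L : u v / u - v} -> (forall a, {morph L : v / a *: v}) -> continuous L ->
  has_deriv_within D f t df -> has_deriv_within D (fun s => L (f s)) t (L df).
Proof.
move=> LB LZ Lc fd; rewrite /has_deriv_within.
have -> : (fun s => (s - t)^-1 *: (L (f s) - L (f t))) =
    L \o (fun s => (s - t)^-1 *: (f s - f t)).
  by apply: funext => s /=; rewrite LZ LB.
by apply: (continuous_cvg _ (Lc df)).
Qed.

Lemma has_deriv_withinZ (V : normedModType K) D (f : K -> V) t df (a : K) :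
  has_deriv_within D f t df ->
  has_deriv_within D (fun s => a *: f s) t (a *: df).
Proof.
apply: has_deriv_within_linear; first exact: scalerBr.
  by move=> b v; rewrite !scalerA mulrC.
exact: scaler_continuous.
Qed.

Lemma has_deriv_withinN (V : normedModType K) D (f : K -> V) t df :
  has_deriv_within D f t df -> has_deriv_within D (fun s => - f s) t (- df).
Proof.
apply: has_deriv_within_linear; first by move=> u v; rewrite opprD.
  by move=> b v; rewrite scalerN.
exact: oppr_continuous.
Qed.

Lemma has_deriv_withinB (V : normedModType K) D (f g : K -> V) t df dg :
  has_deriv_within D f t df -> has_deriv_within D g t dg ->
  has_deriv_within D (fun s => f s - g s) t (df - dg).
Proof. by move=> fd /has_deriv_withinN; exact: has_deriv_withinD. Qed.


(** The increment splits as B (f s - f t) (g s) + B (f t) (g s - g t), after which joint continuity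
    of [B] suffices. One proof thus serves the scalar, dot and cross products. *)
Lemma has_deriv_within_bilinear (U V W : normedModType K) D (B : U -> V -> W)
    (f : K -> U) (g : K -> V) t df dg :
  (forall v, {morph B^~ v : u u' / u - u'}) -> (forall u, {morph B u : v v' / v - v'}) ->
  (forall a u v, B (a *: u) v = a *: B u v) ->
  (forall a u v, B u (a *: v) = a *: B u v) ->
  continuous (fun p : U * V => B p.1 p.2) ->
  has_deriv_within D f t df -> has_deriv_within D g t dg ->
  has_deriv_within D (fun s => B (f s) (g s)) t (B df (g t) + B (f t) dg).
Proof.
move=> BBl BBr BZl BZr Bc fd gd; rewrite /has_deriv_within.
have -> : (fun s => (s - t)^-1 *: (B (f s) (g s) - B (f t) (g t))) =
    (fun s => B ((s - t)^-1 *: (f s - f t)) (g s)) +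
    (fun s => B (f t) ((s - t)^-1 *: (g s - g t))).
  apply: funext => s; rewrite -[RHS]/(_ + _) BZl BZr -scalerDr BBl BBr.
  by rewrite addrA subrK.
have gt : g s @[s --> within D (dnbhs t)] --> g t.
  apply: cvg_trans (has_deriv_within_continuous gd) => A /= hA.
  by move: hA; rewrite /within /dnbhs /within; apply: (@filterS _ (nbhs t)) => s h _; exact: h.
apply: cvgD.
  exact: (cvg_comp _ _ (cvg_pair fd gt) (Bc (df, g t))).
exact: (cvg_comp _ _ (cvg_pair (cvg_cst (f t)) gd) (Bc (f t, dg))).
Qed.

Lemma has_deriv_within_pair (U V : normedModType K) D
    (f : K -> U) (g : K -> V) t df dg :
  has_deriv_within D f t df -> has_deriv_within D g t dg ->
  has_deriv_within D (fun s => (f s, g s) : U * V) t (df, dg).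
Proof. by move=> fd gd; apply: cvg_pair. Qed.

Lemma has_deriv_within_fst (U V : normedModType K) D (f : K -> U * V) t d :
  has_deriv_within D f t d -> has_deriv_within D (fun s => (f s).1) t d.1.
Proof. by apply: has_deriv_within_linear => //; move=> p; exact: cvg_fst. Qed.

Lemma has_deriv_within_snd (U V : normedModType K) D (f : K -> U * V) t d :
  has_deriv_within D f t d -> has_deriv_within D (fun s => (f s).2) t d.2.
Proof. by apply: has_deriv_within_linear => //; move=> p; exact: cvg_snd. Qed.

Lemma has_deriv_withinM D (f g : K -> K) t df dg :
  has_deriv_within D f t df -> has_deriv_within D g t dg ->
  has_deriv_within D (fun s => f s * g s) t (df * g t + f t * dg).
Proof.
apply: (@has_deriv_within_bilinear K K K D *%R).
- by move=> v u u'; rewrite mulrBl.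
- by move=> v u u'; rewrite mulrBr.
- by move=> a u v; rewrite -mulrA.
- by move=> a u v; rewrite [LHS]mulrCA.
- exact: mul_continuous.
Qed.

Lemma has_deriv_within_sqrt D (f : K -> K) t df :
  (forall s, 0 < f s) -> has_deriv_within D f t df ->
  has_deriv_within D (fun s => Num.sqrt (f s)) t (df / (2 * Num.sqrt (f t))).
Proof.
move=> f0 fd; rewrite /has_deriv_within.
have sq0 s : 0 < Num.sqrt (f s) by rewrite sqrtr_gt0.
(* Rationalising the difference of roots; positivity of [f] everywhere keeps the new denominator
   nonzero for every [s]. *)
have -> : (fun s => (s - t)^-1 *: (Num.sqrt (f s) - Num.sqrt (f t))) =
    (fun s => ((s - t)^-1 *: (f s - f t)) / (Num.sqrt (f s) + Num.sqrt (f t))).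
  apply: funext => s; rewrite -[_ *: _ in RHS]/(_ * _) -mulrA; congr (_ * _).
  rewrite -{2}(sqr_sqrtr (ltW (f0 s))) -{2}(sqr_sqrtr (ltW (f0 t))) subr_sqr mulfK//.
  by rewrite gt_eqF // addr_gt0.
have ft : Num.sqrt (f s) @[s --> within D (dnbhs t)] --> Num.sqrt (f t).
  apply: (continuous_cvg _ (@sqrt_continuous K (f t))).
  apply: cvg_trans (has_deriv_within_continuous fd) => A /= hA.
  by move: hA; rewrite /within /dnbhs /within; apply: (@filterS _ (nbhs t)) => s h _; exact: h.
apply: cvgM => //; rewrite mulr_natl mulr2n.
apply: cvgV; first by rewrite gt_eqF // addr_gt0.
by apply: cvgD => //; exact: cvg_cst.
Qed.

Lemma has_deriv_within_derive1 D (f : K -> K) t df :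
  is_derive t 1 f df -> has_deriv_within D f t df.
Proof.
move=> [fd <-]; apply/has_deriv_withinP => e e0.
have /cvgrPdistC_le/(_ _ e0)/nbhs_ballP[r /= r0 hr] := fd.
exists r => // s Ds st.
have [->|nst] := eqVneq s t.
  by rewrite !subrr scale0r subrr normr0 mulr0.
have st0 : s - t != 0 by rewrite subr_eq0.
have := hr (s - t); rewrite -ball_normE /= sub0r normrN => /(_ st st0).
rewrite /= -[_ *: 1]/(_ * 1) mulr1 subrK => h.
have -> : f s - f t - (s - t) *: 'D_1 f t
    = (s - t) *: ((s - t)^-1 *: (f s - f t) - 'D_1 f t).
  by rewrite scalerBr scalerA mulfV // scale1r.
by rewrite normrZ mulrC ler_wpM2r.
Qed.

Lemma is_derive_has_deriv_within D (f : K -> K) t df :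
  nbhs t D -> has_deriv_within D f t df -> is_derive t 1 f df.
Proof.
move=> /nbhs_ballP[q /= q0 tD] /has_deriv_withinP fd.
have cv : h^-1 *: ((f \o shift t) (h *: 1) - f t) @[h --> 0^'] --> df.
  apply/cvgrPdistC_le => e e0; have [r r0 hr] := fd e e0.
  apply/nbhs_ballP; exists (Num.min r q) => [|h]; first by rewrite /= lt_min r0 q0.
  rewrite -ball_normE /= sub0r normrN lt_min => /andP[hlr hq] h0.
  rewrite -[h *: 1]/(h * 1) mulr1.
  have Dh : D (h + t).
    by apply: tD; rewrite -ball_normE /= opprD addrCA subrr addr0 normrN.
  have := hr (h + t) Dh; rewrite addrK => /(_ hlr) {}hr.
  have -> : h^-1 *: (f (h + t) - f t) - df
      = h^-1 *: (f (h + t) - f t - h *: df).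
    by rewrite [RHS]scalerBr scalerA mulVf // scale1r.
  by rewrite normrZ normfV mulrC ler_pdivrMr // normr_gt0.
split; first by apply/cvg_ex; exists df.
exact: (cvg_lim _ cv).
Qed.

(** At interior points the segment is a neighbourhood, so the relative derivative is an ordinary one
    and the mean value theorem applies; the endpoints need only continuity. *)
Lemma has_deriv_within_nincr (f df : K -> K) (a b : K) : a <= b ->
  (forall t, t \in `[a, b] -> has_deriv_within `[a, b] f t (df t)) ->
  (forall t, t \in `[a, b] -> df t <= 0) -> f b <= f a.
Proof.
move=> ab fd df0.
have drv x : x \in `]a, b[ -> is_derive x 1 f (df x).
  move=> xab; apply: (is_derive_has_deriv_within (D := `[a, b])).
    have /= := near_in_itvoo xab; apply: filterS => y; exact: subset_itv_oo_cc.
  apply: fd; exact: (subset_itv_oo_cc xab).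
have /(MVT_segment ab drv)[c cab] : {within `[a, b], continuous f}.
  exact: (has_deriv_within_continuous_within (df := df)).
by move/eqP; rewrite -subr_le0 => /eqP ->; rewrite mulr_le0_ge0 ?df0 ?subr_ge0.
Qed.

(** Vector values admit no mean value equality, so the inequality is propagated from [a] by
    continuous induction: the supremum of the times up to which it holds satisfies it too, and can
    be passed unless it is [b]. *)
Lemma has_deriv_within_mvt (V : normedModType K) (f df : K -> V) (c : V)
    (e a b : K) : a <= b ->
  (forall t, t \in `[a, b] -> has_deriv_within `[a, b] f t (df t)) ->
  (forall t, t \in `[a, b] -> `|df t - c| <= e) ->
  `|f b - f a - (b - a) *: c| <= e * (b - a).
Proof.
move=> ab fd dfc; apply/ler_addgt0Pl => q q0.
have [|nab] := eqVneq a b.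
  by move=> ->; rewrite !subrr scale0r subrr normr0 mulr0 addr0 ltW.
have {ab nab} ab : a < b by rewrite lt_neqAle nab.
(* The slack [q], spread evenly over the segment, absorbs the first-order remainder at every
   point. *)
pose e' := e + q / (b - a).
have e'E : q + e * (b - a) = e' * (b - a).
  by rewrite mulrDl addrC divfK // gt_eqF // subr_gt0.
rewrite {}e'E.
pose g t := f t - t *: c.
have gE s t : g s - g t = f s - f t - (s - t) *: c.
  by rewrite /g scalerBl !opprB [t *: c - f t]addrC addrACA [- (s *: c) + _]addrC.
have gloc t : t \in `[a, b] -> exists2 r, 0 < r & forall s, s \in `[a, b] ->
    `|s - t| < r -> `|g s - g t| <= e' * `|s - t|.
  move=> tab; have /has_deriv_withinP/(_ (q / (b - a))) := fd t tab.
  case=> [|r r0 hr]; first by rewrite divr_gt0 // subr_gt0.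
  exists r => // s sab st; have := hr s sab st.
  have -> : g s - g t = (f s - f t - (s - t) *: df t) + (s - t) *: (df t - c).
    by rewrite gE scalerBr addrA subrK.
  move=> h; apply: (le_trans (ler_normD _ _)).
  rewrite mulrDl addrC lerD // normrZ mulrC ler_wpM2r //; exact: dfc.
pose S := [set t | t \in `[a, b] /\ forall s, a <= s <= t ->
  `|g s - g a| <= e' * (s - a)].
have Sa : S a.
  split; first by rewrite in_itv /= lexx ltW.
  by move=> s /andP[s1 s2]; rewrite (@le_anti _ _ s a) ?s1 ?s2 // !subrr normr0 mulr0.
have Sub : has_ubound S by exists b => t [/[!in_itv]/= /andP[]].
have Ssup : has_sup S by split => //; exists a.
pose m := sup S.
have am : a <= m by exact: ub_le_sup.
have mb : m <= b by apply: ge_sup; [exists a | move=> t [/[!in_itv]/= /andP[]]].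
have mab : m \in `[a, b] by rewrite in_itv /= am mb.
have [r r0 hr] := gloc m mab.
have below s : a <= s -> s < m -> `|g s - g a| <= e' * (s - a).
  move=> as_ sm; have [t [tab tS] st] := sup_gt Ssup.1 sm.
  by apply: tS; rewrite as_ ltW.
have atm : `|g m - g a| <= e' * (m - a).
  have [t St mt] := sup_adherent r0 Ssup.
  have [tab tS] := St; have tm : t <= m by exact: ub_le_sup.
  have := hr t tab; rewrite distrC ger0_norm ?subr_ge0 // ltrBlDl -ltrBlDr => /(_ mt) h.
  have -> : g m - g a = (g m - g t) + (g t - g a) by rewrite addrA subrK.
  apply: (le_trans (ler_normD _ _)); rewrite distrC.
  have -> : e' * (m - a) = e' * (m - t) + e' * (t - a) by ring.
  rewrite lerD //; apply: tS; rewrite lexx andbT.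
  by move: tab; rewrite in_itv /= => /andP[].
have above s : s \in `[a, b] -> m <= s -> s < m + r -> `|g s - g a| <= e' * (s - a).
  move=> sab ms sr; have := hr s sab; rewrite ger0_norm ?subr_ge0 // ltrBlDl => /(_ sr) h.
  have -> : g s - g a = (g s - g m) + (g m - g a) by rewrite addrA subrK.
  apply: (le_trans (ler_normD _ _)).
  have -> : e' * (s - a) = e' * (s - m) + e' * (m - a) by ring.
  by rewrite lerD.
have bm : b <= m.
  rewrite leNgt; apply/negP => mltb.
  pose t := Num.min b (m + r / 2).
  have mt : m < t by rewrite lt_min mltb ltrDl divr_gt0.
  have tb : t <= b by rewrite ge_min lexx.
  have tr : t < m + r.
    by rewrite gt_min; apply/orP; right; rewrite ltrD2l ltr_pdivrMr //; lra.
  suff /(ub_le_sup Sub) : S t by rewrite leNgt mt.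
  split=> [|s /andP[as_ st]]; first by rewrite in_itv /= tb (le_trans am) // ltW.
  have [sm|ms] := ltP s m; first exact: below.
  by apply: above => //; [rewrite in_itv /= as_ (le_trans st) | exact: le_lt_trans tr].
by rewrite -gE; have -> : b = m by apply/le_anti; rewrite bm mb.
Qed.

End WithinDerivative.

(** * Peano's existence theorem and continuation of solutions *)

(** An ultrafilter contains each set or its complement. A neighbourhood of a cluster point cannot
    have its complement in the image filter, so the cluster point is a limit. *)
Lemma compact_ultra_cvg (I : Type) (T : topologicalType) (A : set T)
    (U : set_system I) (X : I -> T) :
  compact A -> UltraFilter U -> U [set i | A (X i)] ->
  exists2 p, A p & X i @[i --> U] --> p.
Proof.
move=> Acpt UU UA; have UF := @ultra_proper _ _ UU.
have [p [Ap clp]] := Acpt (X @ U) _ UA.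
exists p => // N pN.
have [//|UN] := in_ultra_setVsetC (X @^-1` N) UU.
by have [q [nNq Nq]] := clp (~` N) N UN pN.
Qed.

Section Peano.
Context {K : realType} {V : normedModType K}.
Hypothesis closed_ball_cpt : forall M : K, compact [set v : V | `|v| <= M].

Fixpoint euler (g : K -> V -> V) (t0 : K) (x0 : V) (h : K) (k : nat) : V :=
  if k is k'.+1 then
    let y := euler g t0 x0 h k' in y + h *: g (t0 + k'%:R * h) y
  else x0.

(** Discrete counterpart of [has_deriv_within_mvt]: the increment is a sum of [m] steps whose slopes
    are all within [e] of [c]. With [c = 0] it gives the Lipschitz bound, with the slope at the
    limit point the derivative. *)
Lemma euler_increment (g : K -> V -> V) (t0 : K) (x0 : V) (h e : K) (c : V)
    (i m : nat) : 0 <= h ->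
  (forall k, (i <= k < i + m)%N ->
     `|g (t0 + k%:R * h) (euler g t0 x0 h k) - c| <= e) ->
  `|euler g t0 x0 h (i + m) - euler g t0 x0 h i - (m%:R * h) *: c|
    <= e * (m%:R * h).
Proof.
move=> h0; elim: m => [|m IH] hg.
  by rewrite addn0 subrr mul0r scale0r subrr normr0 mulr0.
rewrite addnS /=; set y := euler _ _ _ _ _ in IH hg *.
set gy := g _ _.
have -> : y + h *: gy - euler g t0 x0 h i - (m.+1%:R * h) *: c =
    (y - euler g t0 x0 h i - (m%:R * h) *: c) + h *: (gy - c).
  rewrite -natr1 mulrDl mul1r scalerDl scalerBr opprD.
  by rewrite [y + _ - _]addrAC -!addrA; congr (_ + (_ + _)); rewrite addrCA.
apply: (le_trans (ler_normD _ _)).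
rewrite -natr1 mulrDl mul1r mulrDr lerD //.
  by apply: IH => k /andP[ik km]; apply: hg; rewrite ik addnS ltnW // ltnS.
rewrite normrZ ger0_norm // mulrC ler_wpM2r //.
by apply: hg; rewrite leq_addr addnS /=.
Qed.

(* The solution is the pointwise limit, along an ultrafilter, of the piecewise
   constant Euler approximations of step [1 / n.+1]; this replaces the
   extraction of a uniformly convergent subsequence. *)
Lemma peano_bounded (g : K -> V -> V) (M t0 : K) (x0 : V) :
  (forall t x, `|g t x| <= M) ->
  exists x : K -> V, [/\ x t0 = x0,
    forall t, t0 <= t -> `|x t - x0| <= M * (t - t0) &
    forall t, t0 <= t -> {for (t, x t), continuous (fun p => g p.1 p.2)} ->
      has_deriv_within [set s | t0 <= s] x t (g t (x t))].
Proof.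
move=> gM.
have M0 : 0 <= M by exact: le_trans (normr_ge0 _) (gM t0 x0).
pose h n : K := n.+1%:R^-1.
have h0 n : 0 < h n by rewrite invr_gt0.
pose idx n t := Num.trunc ((t - t0) * n.+1%:R).
have idx_le n t : t0 <= t -> (idx n t)%:R * h n <= t - t0.
  move=> tt; have /truncn_itv/andP[lo _] : 0 <= (t - t0) * n.+1%:R.
    by rewrite mulr_ge0 // subr_ge0.
  by rewrite /h ler_pdivrMr.
have idx_gt n t : t0 <= t -> t - t0 < (idx n t)%:R * h n + h n.
  move=> tt; have /truncn_itv/andP[_ hi] : 0 <= (t - t0) * n.+1%:R.
    by rewrite mulr_ge0 // subr_ge0.
  have -> : (idx n t)%:R * h n + h n = (idx n t).+1%:R * h n.
    by rewrite -natr1 mulrDl mul1r.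
  by rewrite ltr_pdivlMr.
have idx_mono n s t : s <= t -> (idx n s <= idx n t)%N.
  by move=> st; apply: le_truncn; rewrite ler_wpM2r // lerD2r.
pose X n t := euler g t0 x0 (h n) (idx n t).
have XM n (i j : nat) : (i <= j)%N ->
    `|euler g t0 x0 (h n) j - euler g t0 x0 (h n) i| <= M * ((j%:R - i%:R) * h n).
  move=> ij; have := @euler_increment g t0 x0 (h n) M 0 i (j - i) (ltW (h0 n)).
  rewrite subnKC // scaler0 subr0 natrB //; apply=> k _; rewrite subr0; exact: gM.
have XB n t : t0 <= t -> `|X n t - x0| <= M * (t - t0).
  move=> tt; apply: le_trans (XM n 0 (idx n t) _) _ => //.
  by rewrite ler_wpM2l // subr0; exact: idx_le.
have [U [UU Uoo]] := @ultraFilterLemma nat \oo _.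
have UF := @ultra_proper _ _ UU.
(* For [t < t0] the value [x0] is a dummy; only times from [t0] on matter. *)
have Xcv t : exists p : V, t0 <= t -> X n t @[n --> U] --> p.
  have [tt|] := boolP (t0 <= t); last by exists x0.
  have cpt := @closed_ball_cpt (M * (t - t0) + `|x0|).
  have [|p _ Xp] := compact_ultra_cvg (X := X ^~ t) cpt UU; last by exists p.
  apply: filterS filterT => n _ /=.
  rewrite -[X n t](subrK x0); apply: (le_trans (ler_normD _ _)).
  by rewrite lerD2r; exact: XB.
have [x xP] := choice Xcv.
have hcv : h n @[n --> U] --> (0 : K).
  by apply: cvg_trans (@cvg_harmonic K) => A; exact: Uoo.
exists x; split.
- have := xP t0 (lexx _).
  have -> : X ^~ t0 = fun=> x0.
    by apply: funext => n; rewrite /X /idx subrr mul0r truncn0.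
  by move=> /(cvg_unique (@norm_hausdorff _ _))/(_ (cvg_cst _)) ->.
- move=> t tt.
  have cv : `|X n t - x0| @[n --> U] --> `|x t - x0|.
    by apply: cvg_norm; apply: cvgB; [exact: xP | exact: cvg_cst].
  apply: ler_cvg_to cv (cvg_cst _) _.
  by apply: filterS filterT => n _; exact: XB.
move=> t tt gc; apply/has_deriv_withinP => e e0.
have /cvgrPdistC_le/(_ _ e0)/nbhs_ballP[r /= r0 hr] := gc.
have M1 : 0 < M + 1 by rewrite ltr_wpDl.
(* Once the step is below [d], grid nodes between [a] and [b] are within [2 * d <= r / 2] of [t],
   and the Euler values there are within [2 * M * d <= r / 2] of [X n t], itself within [r / 4] of
   [x t]. All slopes are then evaluated in the ball where [g] is [e]-close to [g t (x t)]. *)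
pose d := r / (4 * (M + 1)).
have d0 : 0 < d by rewrite divr_gt0 // mulr_gt0.
have dM : M * d + d = r / 4.
  by rewrite /d; field; rewrite gt_eqF.
have Md0 : 0 <= M * d by rewrite mulr_ge0 // ltW.
exists d => // s; rewrite /= => ts std.
have main a b : t0 <= a -> a <= b -> a <= t <= b -> b - a < d ->
    `|x b - x a - (b - a) *: g t (x t)| <= e * (b - a).
  move=> ta ab /andP[at_ tb] bad.
  have tb0 := le_trans ta ab.
  pose m n := (idx n b - idx n a)%N.
  have mE n : (m n)%:R = (idx n b)%:R - (idx n a)%:R :> K.
    by rewrite natrB // idx_mono.
  have mcv : (m n)%:R * h n @[n --> U] --> b - a.
    apply/cvgrPdist_le => q q0.
    have /cvgrPdist_le/(_ _ q0) := hcv; apply: filterS => n.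
    rewrite sub0r normrN gtr0_norm // => hq; apply: le_trans hq.
    have := idx_le n _ ta; have := idx_gt n _ ta.
    have := idx_le n _ tb0; have := idx_gt n _ tb0.
    rewrite mE mulrBl ler_norml; lra.
  have cv1 : `|X n b - X n a - ((m n)%:R * h n) *: g t (x t)| @[n --> U] -->
      `|x b - x a - (b - a) *: g t (x t)|.
    apply: cvg_norm; apply: cvgB; first by apply: cvgB; exact: xP.
    exact: cvgZr_tmp.
  have cv2 : e * ((m n)%:R * h n) @[n --> U] --> e * (b - a).
    by apply: cvgM => //; exact: cvg_cst.
  apply: ler_cvg_to cv1 cv2 _.
  have hd : \forall n \near U, h n < d.
    have /cvgrPdist_lt/(_ _ d0) := hcv; apply: filterS => n.
    by rewrite sub0r normrN gtr0_norm.
  have r40 : 0 < r / 4 by rewrite divr_gt0.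
  have Xd : \forall n \near U, `|X n t - x t| < r / 4.
    have /cvgrPdistC_lt/(_ _ r40) := xP t tt; exact.
  apply: filterS2 hd Xd => n hnd Xnt.
  rewrite /X -{1}(subnKC (idx_mono n _ _ ab)) -/(m n).
  apply: euler_increment; first exact: ltW.
  move=> k /andP[ak kb]; rewrite subnKC ?idx_mono // in kb.
  have akR : (idx n a)%:R * h n <= k%:R * h n by rewrite ler_pM2r // ler_nat.
  have kbR : k%:R * h n + h n <= (idx n b)%:R * h n.
    have -> : k%:R * h n + h n = k.+1%:R * h n by rewrite -natr1 mulrDl mul1r.
    by rewrite ler_pM2r // ler_nat.
  have ga := idx_gt n _ ta; have lb := idx_le n _ tb0.
  have gt_ := idx_gt n _ tt; have lt_ := idx_le n _ tt.
  have hn0 := h0 n.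
  have tb_ : `|t - (t0 + k%:R * h n)| < r by rewrite ltr_norml; lra.
  suff yb : `|x t - euler g t0 x0 (h n) k| < r.
    by apply: (hr (_, _)); split; rewrite -ball_normE.
  rewrite distrC.
  have uX : `|euler g t0 x0 (h n) k - X n t| <= M * (2 * d).
    have [kt|tk] := leqP k (idx n t).
      rewrite distrC; apply: (le_trans (XM _ _ _ kt)); rewrite ler_wpM2l // mulrBl.
      lra.
    apply: (le_trans (XM _ _ _ (ltnW tk))); rewrite ler_wpM2l // mulrBl.
    lra.
  rewrite -[_ - x t](subrKA (X n t)).
  apply: (le_lt_trans (ler_normD _ _)); lra.
have [st|/ltW st] := leP s t.
  rewrite distrC ger0_norm ?subr_ge0 // in std *.
  have -> : x s - x t - (s - t) *: g t (x t) =
      - (x t - x s - (t - s) *: g t (x t)).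
    by rewrite [RHS]opprD [- (x t - x s)]opprB -(opprB t s) scaleNr.
  by rewrite normrN; apply: main; rewrite ?lexx ?st.
rewrite ger0_norm ?subr_ge0 // in std *.
by apply: main; rewrite ?lexx ?st.
Qed.

(** Setting [G] to 0 outside a small ball makes it bounded but possibly discontinuous on the
    boundary. This is why [peano_bounded] asks for continuity only at the points of the curve: they
    lie in the open ball for a short time. *)
Lemma peano (G : K -> V -> V) (t0 : K) (x0 : V) :
  (\forall p \near (t0, x0), {for p, continuous (fun p => G p.1 p.2)}) ->
  exists2 d, 0 < d & exists2 x : K -> V, x t0 = x0 &
    forall t, t0 <= t < t0 + d ->
      has_deriv_within [set s | t0 <= s] x t (G t (x t)).
Proof.
move=> Gc; have Gc0 := nbhs_singleton Gc.
have /nbhs_ballP[r1 /= r10 hr1] := Gc.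
have /cvgrPdistC_le/(_ _ ltr01)/nbhs_ballP[r2 /= r20 hr2] := Gc0.
pose r := Num.min r1 r2.
have r0 : 0 < r by rewrite lt_min r10 r20.
pose M := `|G t0 x0| + 1.
have M0 : 0 < M by rewrite ltr_wpDl.
pose g t x := if `[< ball (t0, x0) r (t, x) >] then G t x else 0.
have gM t x : `|g t x| <= M.
  rewrite /g; case: asboolP => [b|_]; last by rewrite normr0 ltW.
  rewrite -[G t x](subrK (G t0 x0)); apply: (le_trans (ler_normD _ _)).
  rewrite /M [leRHS]addrC lerD2r; apply: (hr2 (t, x)).
  by apply: le_ball b; rewrite ge_min lexx orbT.
have [x [xt0 xM xd]] := @peano_bounded g M t0 x0 gM.
(* [r] keeps the time coordinate in the ball, [r / M] the space coordinate, since the curve has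
   speed at most [M]. *)
exists (Num.min r (r / M)); first by rewrite lt_min r0 divr_gt0.
exists x => // t /andP[tt]; rewrite -ltrBlDl lt_min => /andP[tr trM].
have bt : ball (t0, x0) r (t, x t).
  split; rewrite -ball_normE /= distrC; first by rewrite ger0_norm ?subr_ge0.
  by apply: le_lt_trans (xM t tt) _; rewrite mulrC -ltr_pdivlMr.
have gG : \forall p \near (t, x t), G p.1 p.2 = g p.1 p.2.
  have /nbhs_ballP[q /= q0 hq] : nbhs (t, x t) (ball (t0, x0) r).
    by apply: open_nbhs_nbhs; split => //; exact: ball_open.
  apply/nbhs_ballP; exists q => // p /hq bp.
  by rewrite /g -surjective_pairing asboolT.
have gGt : g t (x t) = G t (x t) by rewrite /g asboolT.
rewrite -gGt; apply: xd => //.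
rewrite /prop_for /continuous_at /= gGt.
apply: cvg_trans (hr1 (t, x t) _).
  exact: near_eq_cvg.
by apply: le_ball bt; rewrite ge_min lexx.
Qed.

(** The bound [M] confines the graph of [y] to a compact set on which [G] is bounded, so [y] is
    Lipschitz and has a limit [p] at [T]. Its left derivative there is [G T p], which is also the
    right derivative of a Peano solution started at [(T, p)]; the two pieces therefore join
    differentiably. *)
Lemma solution_extension (G : K -> V -> V) (s0 T M : K) (y : K -> V) :
  s0 < T ->
  (forall t, s0 <= t < T -> has_deriv_within [set s | s0 <= s < T] y t (G t (y t))) ->
  (forall t, s0 <= t < T -> `|y t| <= M) ->
  (forall t x, s0 <= t -> {for (t, x), continuous (fun p => G p.1 p.2)}) ->
  exists2 T', T < T' & exists2 y' : K -> V, (forall t, t < T -> y' t = y t) &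
    forall t, s0 <= t < T' ->
      has_deriv_within [set s | s0 <= s < T'] y' t (G t (y' t)).
Proof.
move=> s0T yd yM Gc.
have [B [B0 hB]] : exists B, 0 <= B /\ forall t x, s0 <= t <= T -> `|x| <= M ->
    `|G t x| <= B.
  have cpt : compact (`[s0, T] `*` [set v : V | `|v| <= M]).
    by apply: compact_setX; [exact: segment_compact | exact: closed_ball_cpt].
  have : compact [set G p.1 p.2 | p in `[s0, T] `*` [set v : V | `|v| <= M]].
    apply: continuous_compact cpt; apply/subspace_continuousP => -[t x] [/= tT xM].
    apply: cvg_within_filter; apply: Gc.
    by move: tT; rewrite in_itv /= => /andP[].
  move=> /compact_bounded[B0 [_ hB0]].
  exists (Num.max 0 (B0 + 1)); split=> [|t x tT xM]; first by rewrite le_max lexx.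
  rewrite le_max; apply/orP; right.
  apply: (hB0 (B0 + 1)); first by rewrite ltrDl.
  by exists (t, x) => //; split => //=; rewrite in_itv.
have mv (c : V) (e s u : K) : s0 <= s -> s <= u -> u < T ->
    (forall t, s <= t <= u -> `|G t (y t) - c| <= e) ->
    `|y u - y s - (u - s) *: c| <= e * (u - s).
  move=> s0s su uT ce.
  apply: (has_deriv_within_mvt (df := fun t => G t (y t)) su) => t tsu.
    move: tsu; rewrite in_itv /= => /andP[st tu].
    apply: (has_deriv_within_subset _ (yd t _)).
      move=> v /=; rewrite in_itv /= => /andP[sv vu].
      by rewrite (le_trans s0s sv) (le_lt_trans vu uT).
    by rewrite (le_trans s0s st) (le_lt_trans tu uT).
  by apply: ce; move: tsu; rewrite in_itv.
have yL s u : s0 <= s -> s <= u -> u < T -> `|y u - y s| <= B * (u - s).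
  move=> s0s su uT; have := mv 0 B s u s0s su uT.
  rewrite scaler0 subr0; apply => t /andP[st tu]; rewrite subr0.
  have h : s0 <= t < T by rewrite (le_trans s0s st) (le_lt_trans tu uT).
  by apply: hB; [case/andP: h => -> /ltW -> | exact: yM].
(* By the Lipschitz bound [yL], a cluster point of [y] at [T] is its limit. *)
have [p [_ clp]] : [set v : V | `|v| <= M] `&` cluster (y @ T^'-) !=set0.
  apply: closed_ball_cpt.
  have : \forall t \near T^'-, `|y t| <= M; last by [].
  near=> t; apply: yM; apply/andP; split; near: t.
    exact: nbhs_left_ge.
  exact: nbhs_left_lt.
have yp s : s0 <= s -> s < T -> `|p - y s| <= B * (T - s).
  move=> s0s sT; apply/ler_addgt0Pl => e e0.
  have := clp (y @` [set u | s < u < T]) (ball p e) _ (nbhsx_ballx _ _ e0).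
  case=> [|_ [[u /andP[su uT] <-]]].
    have : \forall t \near T^'-, (y @` [set u | s < u < T]) (y t); last by [].
    near=> t; exists t => //=; apply/andP; split; near: t.
      exact: nbhs_left_gt.
    exact: nbhs_left_lt.
  rewrite -ball_normE /= => pu.
  rewrite -(subrKA (y u)); apply: (le_trans (ler_normD _ _)).
  rewrite lerD ?(ltW pu) //; apply: (le_trans (yL _ _ s0s (ltW su) uT)).
  by rewrite ler_wpM2l // lerD2r ltW.
pose c := G T p.
have yT e : 0 < e -> exists2 r, 0 < r & forall s, s0 <= s -> s < T -> T - s < r ->
    `|p - y s - (T - s) *: c| <= e * (T - s).
  move=> e0; have /cvgrPdistC_le/(_ _ e0)/nbhs_ballP[r /= r0 hr] := Gc T p (ltW s0T).
  have B1 : 0 < B + 1 by rewrite ltr_wpDl.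
  exists (r / (B + 1)); first by rewrite divr_gt0.
  move=> s s0s sT sr.
  have Tsr : (T - s) * (B + 1) < r by rewrite -ltr_pdivlMr.
  apply/ler_addgt0Pl => q q0.
  have c1 : 0 < B + `|c| + 1 by rewrite ltr_wpDl // addr_ge0.
  (* The estimate [mv] is available only strictly before [T]; with this [u] the remaining stretch
     from [u] to [T] costs at most [q]. *)
  pose u := Num.max s (T - q / (B + `|c| + 1)).
  have su : s <= u by rewrite le_max lexx.
  have uT : u < T by rewrite gt_max sT ltrBlDr ltrDl divr_gt0.
  have uq : (T - u) * (B + `|c|) <= q.
    apply: (@le_trans _ _ ((T - u) * (B + `|c| + 1))).
      by rewrite ler_wpM2l ?subr_ge0 ?(ltW uT) // lerDl.
    by rewrite -ler_pdivlMr // lerBlDr -lerBlDl le_max lexx orbT.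
  have h1 : `|y u - y s - (u - s) *: c| <= e * (u - s).
    apply: mv => // t /andP[st tu].
    have tT := le_lt_trans tu uT.
    apply: (hr (t, y t)); split; rewrite -ball_normE /=.
      rewrite gtr0_norm ?subr_gt0 //; apply: le_lt_trans Tsr.
      have : T - t <= T - s by rewrite lerD2l lerN2.
      nra.
    apply: le_lt_trans (yp t (le_trans s0s st) tT) _; apply: le_lt_trans Tsr.
    nra.
  have h2 := yp u (le_trans s0s su) uT.
  have -> : p - y s - (T - s) *: c =
      (p - y u) + (y u - y s - (u - s) *: c) - (T - u) *: c.
    have -> : T - s = (T - u) + (u - s) by ring.
    rewrite scalerDl [p - y u + _]addrA subrKA opprD [LHS]addrA.
    exact: addrAC.
  apply: (le_trans (ler_normB _ _)); rewrite normrZ gtr0_norm ?subr_gt0 //.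
  have h3 := ler_normD (p - y u) (y u - y s - (u - s) *: c).
  have eu : e * (u - s) <= e * (T - s) by rewrite ler_wpM2l ?ltW // ltrD2r.
  lra.
have [d d0 [x xT xd]] : exists2 d, 0 < d & exists2 x : K -> V, x T = p &
    forall t, T <= t < T + d -> has_deriv_within [set s | T <= s] x t (G t (x t)).
  apply: peano; have Ts0 : 0 < T - s0 by rewrite subr_gt0.
  apply/nbhs_ballP; exists (T - s0) => // -[t v] [/=]; rewrite -ball_normE /=.
  move=> tT _; apply: Gc; move: tT; rewrite ltr_norml; lra.
exists (T + d); first by rewrite ltrDl.
pose y' t := if t < T then y t else x t.
exists y' => [t tT|t /andP[s0t tTd]]; first by rewrite /y' tT.
rewrite /y'; case: (ltgtP t T) => [tT|Tt|->].
- apply: (@has_deriv_within_local _ _ _ [set s | s0 <= s < T] y _ _ _ (T - t)).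
  + by rewrite subr_gt0.
  + move=> s /= /andP[s0s _]; rewrite ltr_norml => /andP[_].
    by rewrite ltrD2r => sT; rewrite s0s sT.
  + by rewrite tT.
  + by apply: yd; rewrite s0t.
- apply: (@has_deriv_within_local _ _ _ [set s | T <= s] x _ _ _ (t - T)).
  + by rewrite subr_gt0.
  + move=> s /= _; rewrite ltr_norml => /andP[h _].
    have Ts : T <= s by lra.
    by rewrite Ts ltNge Ts.
  + by rewrite ltNge ltW.
  + by apply: xd; rewrite ltW.
- rewrite xT; apply/has_deriv_withinP => e e0.
  have [r1 r10 hr1] := yT e e0.
  have TT : T <= T < T + d by rewrite lexx ltrDl.
  have /has_deriv_withinP/(_ e e0)[r2 r20 hr2] := xd T TT.
  exists (Num.min r1 r2); first by rewrite lt_min r10 r20.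
  move=> s /= /andP[s0s _]; rewrite lt_min ltxx => /andP[sr1 sr2].
  have [sT|Ts] := ltP s T; last by rewrite xT; have := hr2 s Ts sr2; rewrite xT.
  rewrite distrC gtr0_norm ?subr_gt0 // in sr1 *.
  have -> : y s - x T - (s - T) *: G T p = - (p - y s - (T - s) *: c).
    by rewrite xT [RHS]opprD [- (p - y s)]opprB -(opprB T s) scaleNr.
  by rewrite normrN; exact: hr1.
Unshelve. all: by end_near. Qed.

End Peano.

(** * Euclidean geometry of dimension three and the inertia matrix *)

Section Euclidean.
Context {K : realType}.

Definition dot n (u v : 'cV[K]_n) : K := \sum_i u i 0 * v i 0.

Lemma dotC n (u v : 'cV[K]_n) : dot u v = dot v u.
Proof. by apply: eq_bigr => i _; rewrite mulrC. Qed.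

Lemma dotDr n (u v w : 'cV[K]_n) : dot u (v + w) = dot u v + dot u w.
Proof. by rewrite -big_split; apply: eq_bigr => i _; rewrite mxE mulrDr. Qed.

Lemma dotZr n a (u v : 'cV[K]_n) : dot u (a *: v) = a * dot u v.
Proof. by rewrite mulr_sumr; apply: eq_bigr => i _; rewrite mxE mulrCA. Qed.

Lemma dotNr n (u v : 'cV[K]_n) : dot u (- v) = - dot u v.
Proof. by rewrite -scaleN1r dotZr mulN1r. Qed.

Lemma dotBr n (u v w : 'cV[K]_n) : dot u (v - w) = dot u v - dot u w.
Proof. by rewrite dotDr dotNr. Qed.

Lemma dotBl n (u v w : 'cV[K]_n) : dot (u - v) w = dot u w - dot v w.
Proof. by rewrite !(dotC _ w) dotBr. Qed.

Lemma dotZl n a (u v : 'cV[K]_n) : dot (a *: u) v = a * dot u v.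
Proof. by rewrite !(dotC _ v) dotZr. Qed.

Lemma dot_ge0 n (u : 'cV[K]_n) : 0 <= dot u u.
Proof. by apply: sumr_ge0 => i _; rewrite -expr2 sqr_ge0. Qed.

Lemma dotE n (u v : 'cV[K]_n) : (u^T *m v) 0 0 = dot u v.
Proof. by rewrite mxE; apply: eq_bigr => i _; rewrite mxE. Qed.

Lemma dot_mulmx n (A : 'M[K]_n) (u v : 'cV[K]_n) : dot u (A *m v) = dot (A^T *m u) v.
Proof. by rewrite -!dotE trmx_mul trmxK mulmxA. Qed.

Lemma enorm_sqr n (u : 'cV[K]_n) : enorm u ^+ 2 = dot u u.
Proof.
rewrite sqr_sqrtr; first by apply: eq_bigr => i _; rewrite expr2.
by apply: sumr_ge0 => i _; rewrite sqr_ge0.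
Qed.

Lemma enormE n (u : 'cV[K]_n) : enorm u = Num.sqrt (dot u u).
Proof. by congr Num.sqrt; apply: eq_bigr => i _; rewrite expr2. Qed.

Lemma enorm_ge0 n (u : 'cV[K]_n) : 0 <= enorm u.
Proof. exact: sqrtr_ge0. Qed.

Lemma enormN n (u : 'cV[K]_n) : enorm (- u) = enorm u.
Proof. by congr Num.sqrt; apply: eq_bigr => i _; rewrite mxE sqrrN. Qed.

Lemma normr_le_enorm m (u : 'cV[K]_m) : `|u| <= enorm u.
Proof.
rewrite [leLHS]/Num.Def.normr /= mx_normrE; apply/bigmax_leP; split=> [|[i j] _ /=].
  exact: enorm_ge0.
rewrite ord1 -(@ler_pXn2r _ 2) ?nnegrE ?enorm_ge0 // enorm_sqr real_normK ?num_real //.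
rewrite /dot (bigD1 i) //= expr2 lerDl; apply: sumr_ge0 => k _.
by rewrite -expr2 sqr_ge0.
Qed.

Lemma enorm_col_mx m n (u : 'cV[K]_m) (v : 'cV[K]_n) :
  enorm (col_mx u v) ^+ 2 = enorm u ^+ 2 + enorm v ^+ 2.
Proof.
rewrite !enorm_sqr /dot big_split_ord /=; congr (_ + _).
  by apply: eq_bigr => i _; rewrite col_mxEu.
by apply: eq_bigr => i _; rewrite col_mxEd.
Qed.

Lemma sum3 (V : nmodType) (F : 'I_3 -> V) : \sum_i F i = F 0 + F 1 + F 2%:R.
Proof.
rewrite !big_ord_recl big_ord0 addr0 addrA.
by congr (_ + F _ + F _); apply: val_inj.
Qed.

Lemma colP3 (u v : 'cV[K]_3) :
  u 0 0 = v 0 0 -> u 1 0 = v 1 0 -> u 2%:R 0 = v 2%:R 0 -> u = v.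
Proof.
move=> h0 h1 h2; apply/colP => -[[|[|[|//]]] h].
- by rewrite (_ : Ordinal h = 0) //; apply: val_inj.
- by rewrite (_ : Ordinal h = 1) //; apply: val_inj.
- by rewrite (_ : Ordinal h = 2%:R) //; apply: val_inj.
Qed.

(** A product of equations serves as a multi-rule for [rewrite]; together with [colP3] it turns
    vector identities into polynomial ones for [ring]. *)
Lemma crossE (a b : 'cV[K]_3) :
  (cross a b 0 0 = a 1 0 * b 2%:R 0 - a 2%:R 0 * b 1 0) *
  (cross a b 1 0 = a 2%:R 0 * b 0 0 - a 0 0 * b 2%:R 0) *
  (cross a b 2%:R 0 = a 0 0 * b 1 0 - a 1 0 * b 0 0).
Proof.
have e11 : (1 + 1 : 'I_3) = 2%:R by apply: val_inj.
have e12 : (1 + 2%:R : 'I_3) = 0 by apply: val_inj.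
have e21 : (2%:R + 1 : 'I_3) = 0 by apply: val_inj.
have e22 : (2%:R + 2%:R : 'I_3) = 1 by apply: val_inj.
by rewrite !mxE !add0r e11 e12 e21 e22.
Qed.

Definition vecE := (crossE, mxE).

(** Both terms on the left are nonnegative: dropping the first gives the Cauchy-Schwarz inequality,
    dropping the second the bound on the cross product. *)
Lemma lagrange_identity (a b : 'cV[K]_3) :
  dot (cross a b) (cross a b) + dot a b ^+ 2 = dot a a * dot b b.
Proof. by rewrite /dot !sum3 !crossE; ring. Qed.

Lemma dot_le_enorm (a b : 'cV[K]_3) : dot a b <= enorm a * enorm b.
Proof.
apply: le_trans (ler_norm _) _.
rewrite -(@ler_pXn2r _ 2) ?nnegrE ?mulr_ge0 ?enorm_ge0 //.
rewrite real_normK ?num_real // exprMn !enorm_sqr -lagrange_identity.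
by rewrite lerDr dot_ge0.
Qed.

Lemma enorm_cross_le (a b : 'cV[K]_3) : enorm (cross a b) <= enorm a * enorm b.
Proof.
rewrite -(@ler_pXn2r _ 2) ?nnegrE ?mulr_ge0 ?enorm_ge0 //.
by rewrite exprMn !enorm_sqr -lagrange_identity lerDl sqr_ge0.
Qed.

Lemma enormB_le (a b : 'cV[K]_3) : enorm (a - b) <= enorm a + enorm b.
Proof.
rewrite -(@ler_pXn2r _ 2) ?nnegrE ?addr_ge0 ?enorm_ge0 //.
rewrite sqrrD !enorm_sqr dotBr !dotBl (dotC b a).
have := dot_le_enorm (- a) b; rewrite enormN -scaleN1r dotZl mulN1r.
lra.
Qed.

Lemma dot_cross_self (a b : 'cV[K]_3) : dot a (cross b a) = 0.
Proof. by rewrite /dot sum3 !crossE; ring. Qed.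

Lemma dot_cross_selfl (a b : 'cV[K]_3) : dot a (cross a b) = 0.
Proof. by rewrite /dot sum3 !crossE; ring. Qed.

Lemma crossDl (a b c : 'cV[K]_3) : cross (a + b) c = cross a c + cross b c.
Proof. by apply: colP3; rewrite !vecE; ring. Qed.

Lemma crossDr (a b c : 'cV[K]_3) : cross c (a + b) = cross c a + cross c b.
Proof. by apply: colP3; rewrite !vecE; ring. Qed.

Lemma crossBl (a b c : 'cV[K]_3) : cross (a - b) c = cross a c - cross b c.
Proof. by apply: colP3; rewrite !vecE; ring. Qed.

Lemma crossBr (a b c : 'cV[K]_3) : cross c (a - b) = cross c a - cross c b.
Proof. by apply: colP3; rewrite !vecE; ring. Qed.

Lemma crossZl k (a b : 'cV[K]_3) : cross (k *: a) b = k *: cross a b.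
Proof. by apply: colP3; rewrite !vecE; ring. Qed.

Lemma crossZr k (a b : 'cV[K]_3) : cross a (k *: b) = k *: cross a b.
Proof. by apply: colP3; rewrite !vecE; ring. Qed.

Lemma dot_triple_cross_le (z a r : 'cV[K]_3) : enorm r = 1 ->
  dot z (cross a (cross r z)) <= enorm z ^+ 2 * enorm a.
Proof.
move=> r1; apply: le_trans (dot_le_enorm _ _) _.
rewrite expr2 -mulrA ler_wpM2l ?enorm_ge0 // mulrC.
apply: le_trans (enorm_cross_le _ _) _; rewrite ler_wpM2l ?enorm_ge0 //.
by apply: le_trans (enorm_cross_le _ _) _; rewrite r1 mul1r.
Qed.

End Euclidean.

(** * Bounds on the inertia matrix and on the error field *)

Section Inertia.
Context {K : realType} (J : 'M[K]_3) (Jm JM : K).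
Hypotheses (J_sym : J^T = J) (Jm_gt0 : 0 < Jm).
Hypotheses (J_ge : mx_ge J Jm%:M) (J_le : mx_ge JM%:M J).

Lemma inertia_ge (x : 'cV[K]_3) : Jm * enorm x ^+ 2 <= dot x (J *m x).
Proof.
have := J_ge x.
rewrite mulmxBr mulmxBl mxE [X in _ + X]mxE subr_ge0 -!mulmxA !dotE.
by rewrite mul_scalar_mx dotZr enorm_sqr.
Qed.

Lemma inertia_le (x : 'cV[K]_3) : dot x (J *m x) <= JM * enorm x ^+ 2.
Proof.
have := J_le x.
rewrite mulmxBr mulmxBl mxE [X in _ + X]mxE subr_ge0 -!mulmxA !dotE.
by rewrite mul_scalar_mx dotZr enorm_sqr.
Qed.

Lemma inertia_unit : J \in unitmx.
Proof.
rewrite -row_free_unit; apply: inj_row_free => v vJ.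
have := inertia_ge v^T; rewrite -{1}J_sym -trmx_mul vJ trmx0.
rewrite /dot big1; last by move=> i _; rewrite [X in _ * X]mxE mulr0.
rewrite pmulr_rle0 // => h.
have {h} h : enorm v^T = 0.
  by apply/eqP; rewrite -sqrf_eq0; apply/eqP/le_anti; rewrite h sqr_ge0.
have : `|v^T| <= 0 by rewrite -h; exact: normr_le_enorm.
by rewrite normr_le0 => /eqP/(congr1 trmx); rewrite trmxK trmx0.
Qed.

Lemma inertia_max_gt0 : 0 < JM.
Proof.
pose x : 'cV[K]_3 := delta_mx 0 0.
have x1 : enorm x ^+ 2 = 1.
  by rewrite enorm_sqr /dot sum3 !mxE /= !mul0r mulr1 !addr0.
have := inertia_ge x; have := inertia_le x; rewrite x1 !mulr1 => h1 h2.
exact: lt_le_trans Jm_gt0 (le_trans h2 h1).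
Qed.

(* Expand [0 <= (J x - JM x)^T J (J x - JM x)] and bound [(J x)^T J (J x)] above. *)
Lemma enorm_inertia_le (x : 'cV[K]_3) : enorm (J *m x) <= JM * enorm x.
Proof.
have JM0 := inertia_max_gt0.
have h1 := inertia_le (J *m x).
have h2 := inertia_ge (J *m x - JM *: x).
have h2' : 0 <= Jm * enorm (J *m x - JM *: x) ^+ 2 by rewrite mulr_ge0 ?sqr_ge0 ?ltW.
have h3 := inertia_le x.
have e1 : dot x (J *m (J *m x)) = enorm (J *m x) ^+ 2.
  by rewrite dot_mulmx J_sym enorm_sqr.
have e2 : dot (J *m x) (J *m x) = enorm (J *m x) ^+ 2 by rewrite enorm_sqr.
rewrite mulmxBr -scalemxAr dotBr !dotBl !dotZr !dotZl e1 e2 in h2.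
rewrite -(@ler_pXn2r _ 2) ?nnegrE ?mulr_ge0 ?enorm_ge0 ?(ltW JM0) //.
rewrite exprMn.
have h4 : JM * enorm (J *m x) ^+ 2 <= JM * (JM * dot x (J *m x)) by nra.
have h5 : enorm (J *m x) ^+ 2 <= JM * dot x (J *m x) by rewrite ler_pM2l in h4.
by apply: le_trans h5 _; rewrite expr2 -mulrA ler_pM2l.
Qed.

Variables (k1 k2 omegaM : K) (l1 l2 : 'cV[K]_3 -> K).
Hypotheses (k1_gt0 : 0 < k1) (k2_gt0 : 0 < k2).

Definition zfield (r1 r2 w z e1 e2 : 'cV[K]_3) : 'cV[K]_3 :=
  invmx J *m (k1 *: cross (r1 + e1) (cross r1 z) + k2 *: cross (r2 + e2) (cross r2 z)
    + cross (J *m (w + z)) (w + z) - cross (J *m w) w).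

Definition efield (l : 'cV[K]_3 -> K) (r w z e : 'cV[K]_3) : 'cV[K]_3 :=
  cross e (w + z) + cross r z - l (w + z) *: e.

(** The left-hand side is the derivative of [omega_hat] minus that of omega, as the product rule
    yields it with r_i x w for r_i'. The gain terms in xi' cancel those brought in by the
    derivatives of [rh1] and [rh2], and the two torques cancel. *)
Lemma observer_zfield (r1 r2 w tau xi rh1 rh2 : 'cV[K]_3) :
  let x := (xi, rh1, rh2) in
  let dx := observer_field J k1 k2 l1 l2 r1 r2 tau x in
  dx.1.1 - k1 *: (invmx J *m (cross dx.1.2 r1 + cross rh1 (cross r1 w)))
    - k2 *: (invmx J *m (cross dx.2 r2 + cross rh2 (cross r2 w)))
    - invmx J *m (cross (J *m w) w + tau)
  = zfield r1 r2 w (omega_hat J k1 k2 r1 r2 x - w) (rh1 - r1) (rh2 - r2).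
Proof.
move=> x dx; rewrite /dx /observer_field /zfield.
set wh := omega_hat _ _ _ _ _ _ => /=.
rewrite [w + (wh - w)]addrC subrK.
rewrite -![invmx J *m _ *m wh]mulmxA !mulmxBl -!mulmxA !skewE.
rewrite !scalemxAr -!mulmxN -!mulmxDr.
congr (invmx J *m _).
(* With these products opaque, the remaining identity is polynomial in coordinates and does not
   involve the entries of [J]. *)
set Jwh := J *m wh; set Jw := J *m w.
apply: colP3; rewrite !vecE; ring.
Qed.

Lemma observer_efield (r w wh rh : 'cV[K]_3) (l : 'cV[K]_3 -> K) :
  cross rh wh - l wh *: (rh - r) - cross r w = efield l r w (wh - w) (rh - r).
Proof.
rewrite /efield [w + (wh - w)]addrC subrK; set a := l wh.
by apply: colP3; rewrite !vecE; ring.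
Qed.

(** In (r_i + e_i) x (r_i x z) the r_i part is made coercive by the gain condition and the e_i part
    is the cubic term. Of the gyroscopic terms only (J z) x w survives, the others being orthogonal
    to z or cancelling; the [omegaM] part of the gain pays for it. *)
Lemma dot_zfield_le (r1 r2 w z e1 e2 : 'cV[K]_3) :
  enorm r1 = 1 -> enorm r2 = 1 -> enorm w <= omegaM ->
  mx_gt (- (k1 *: (skew r1 *m skew r1)) - k2 *: (skew r2 *m skew r2))
        (JM * (omegaM + 3 / 2))%:M ->
  dot z (J *m zfield r1 r2 w z e1 e2) <=
    - (3 / 2 * JM * enorm z ^+ 2) + enorm z ^+ 2 * (k1 * enorm e1 + k2 * enorm e2).
Proof.
move=> r11 r21 wM gain; have JM0 := inertia_max_gt0.
rewrite /zfield mulmxA mulmxV ?inertia_unit // mul1mx.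
have -> : cross (J *m (w + z)) (w + z) =
    cross (J *m w) w + cross (J *m w) z + cross (J *m z) w + cross (J *m z) z.
  rewrite mulmxDr !(crossDl, crossDr) !addrA; congr (_ + _).
  exact: addrAC.
have main : k1 * dot z (cross r1 (cross r1 z)) + k2 * dot z (cross r2 (cross r2 z))
    <= - (JM * (omegaM + 3 / 2) * enorm z ^+ 2).
  have [->|z0] := eqVneq z 0.
    have d0 (u : 'cV[K]_3) : dot 0 u = 0 by rewrite /dot big1 // => i _; rewrite mxE mul0r.
    by rewrite !d0 enorm_sqr d0 !mulr0 addr0 oppr0.
  have := gain z z0.
  rewrite mulmxBr mulmxBl mxE [X in _ + X]mxE -!mulmxA !dotE mul_scalar_mx dotZr.
  rewrite mulmxBl dotBr mulNmx dotNr -!scalemxAl !dotZr -!mulmxA !skewE enorm_sqr.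
  lra.
have gyro : dot z (cross (J *m z) w) <= JM * omegaM * enorm z ^+ 2.
  apply: le_trans (dot_le_enorm _ _) _.
  rewrite expr2 mulrCA mulrC [leRHS]mulrA ler_wpM2r ?enorm_ge0 //.
  rewrite mulrC.
  apply: le_trans (enorm_cross_le _ _) _.
  have -> : JM * omegaM * enorm z = JM * enorm z * omegaM by ring.
  by rewrite ler_pM ?enorm_ge0 // enorm_inertia_le.
have t1 := dot_triple_cross_le z e1 r11; have t2 := dot_triple_cross_le z e2 r21.
rewrite !crossDl !scalerDr !(dotDr, dotNr) !dotZr !dot_cross_self.
have := ler_wpM2l (ltW k1_gt0) t1; have := ler_wpM2l (ltW k2_gt0) t2.
lra.
Qed.

(** The transport term e x (w + z) is orthogonal to e, so only r x z and the gain contribute. *)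
Lemma dot_efield_le (l : 'cV[K]_3 -> K) (r w z e : 'cV[K]_3) : enorm r = 1 ->
  dot e (efield l r w z e) <= enorm e * enorm z - l (w + z) * enorm e ^+ 2.
Proof.
move=> r1; rewrite /efield dotBr dotDr dotZr dot_cross_selfl add0r -enorm_sqr lerD2r.
apply: le_trans (dot_le_enorm _ _) _; rewrite ler_wpM2l ?enorm_ge0 //.
by apply: le_trans (enorm_cross_le _ _) _; rewrite r1 mul1r.
Qed.

End Inertia.

(** * Lyapunov estimates *)

Section Lyapunov.
Context {K : realType}.

Lemma smoothed_norm_bounds (q eps : K) : 0 <= q -> 0 < eps ->
  let W := Num.sqrt (q + eps ^+ 2) in
  [/\ 0 < W, W ^+ 2 = q + eps ^+ 2, eps <= W, Num.sqrt q <= W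
    & W <= Num.sqrt q + eps].
Proof.
move=> q0 e0 W.
have e2 : 0 < eps ^+ 2 by rewrite exprn_gt0.
have W0 : 0 < W by rewrite sqrtr_gt0 ltr_wpDl.
have WW : W ^+ 2 = q + eps ^+ 2 by rewrite sqr_sqrtr // addr_ge0 // ltW.
have sq := sqr_sqrtr q0; have sq0 := sqrtr_ge0 q.
split => //.
- by rewrite -(@ler_pXn2r _ 2) ?nnegrE ?(ltW W0) ?(ltW e0) // WW lerDr.
- by rewrite -(@ler_pXn2r _ 2) ?nnegrE ?(ltW W0) // WW sq lerDl ltW.
- rewrite -(@ler_pXn2r _ 2) ?nnegrE ?(ltW W0) ?addr_ge0 ?(ltW e0) //.
  by rewrite WW sqrrD sq lerD2r lerDl mulrn_wge0 // mulr_ge0 // ltW.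
Qed.

(** Here JM n^2 >= q = W^2 - eps^2, so division by [W] turns the quadratic decay into a linear one,
    up to eps^2 / W <= eps. In the cubic term one factor [n] is bounded by [s] and the other by W /
    sqrt Jm. *)
Lemma kinetic_rate (Jm JM n q s kappa D eps : K) :
  0 < Jm -> 0 < eps -> 0 <= n -> n <= s -> 0 <= kappa ->
  Jm * n ^+ 2 <= q -> q <= JM * n ^+ 2 ->
  D <= - (3 / 2 * JM * n ^+ 2) + n ^+ 2 * kappa ->
  let W := Num.sqrt (q + eps ^+ 2) in
  D / W <= - (3 / 2 * W) + 3 / 2 * eps + s / Num.sqrt Jm * kappa.
Proof.
move=> Jm0 e0 n0 ns k0 Jq qJ Dle /=; set W := Num.sqrt (q + _).
have q0 : 0 <= q by apply: le_trans Jq; rewrite mulr_ge0 ?sqr_ge0 ?ltW.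
have [W0 WW eW qW _] := smoothed_norm_bounds q0 e0; rewrite -/W in W0 WW eW qW.
set a := Num.sqrt Jm.
have a0 : 0 < a by rewrite sqrtr_gt0.
have anW : a * n <= W.
  apply: le_trans qW; rewrite -[n]ger0_norm // -sqrtr_sqr /a -sqrtrM ?(ltW Jm0) //.
  exact: ler_wsqrtr.
rewrite ler_pdivrMr //.
have h1 : n ^+ 2 <= s / a * W.
  rewrite expr2 -mulrA; apply: ler_pM => //.
  by rewrite mulrC ler_pdivlMr // mulrC.
have h2 := ler_wpM2r k0 h1.
have h3 : eps * eps <= eps * W by rewrite ler_pM2l.
rewrite -expr2 in h3.
have -> : (- (3 / 2 * W) + 3 / 2 * eps + s / a * kappa) * W =
    - (3 / 2 * W ^+ 2) + 3 / 2 * (eps * W) + s / a * W * kappa by ring.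
rewrite WW.
apply: le_trans Dle _.
set x := s / a * W * kappa in h2 *; set y := n ^+ 2 * kappa in h2 *.
lra.
Qed.

Lemma output_rate (m n L D eps : K) : 0 < eps -> 0 <= n -> 0 <= m -> 0 <= L ->
  D <= m * n - L * m ^+ 2 ->
  let N := Num.sqrt (m ^+ 2 + eps ^+ 2) in
  D / N <= n - L * N + L * eps.
Proof.
move=> e0 n0 m0 L0 Dle /=; set N := Num.sqrt _.
have [N0 NN eN mN _] := smoothed_norm_bounds (sqr_ge0 m) e0.
rewrite -/N in N0 NN eN mN.
rewrite sqrtr_sqr ger0_norm // in mN.
rewrite ler_pdivrMr //; apply: le_trans Dle _.
have h1 : m * n <= n * N by rewrite mulrC ler_wpM2l.
have h2 : L * (eps * eps) <= L * (eps * N) by rewrite ler_wpM2l // ler_pM2l.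
rewrite -expr2 in h2.
have -> : (n - L * N + L * eps) * N = n * N - L * N ^+ 2 + L * (eps * N) by ring.
rewrite NN mulrDr; lra.
Qed.

(* With [kappa = k / Jm] the gain condition gives
   [L - 2 kappa s >= s (1 - kappa + 2 kappa^2) >= 7 s / 8]. *)
Lemma gain_absorbs (Jm k s L m N : K) : 0 < Jm -> 0 <= s -> 0 <= k -> 0 <= m -> m <= N ->
  s * (1 + k / Jm * (1 + 2 * k / Jm)) <= L ->
  s / Num.sqrt Jm * (k * m) <= Num.sqrt Jm / 2 * ((L - s / 2) * N).
Proof.
move=> Jm0 s0 k0 m0 mN hL.
set a := Num.sqrt Jm.
have a0 : 0 < a by rewrite sqrtr_gt0.
have aa : a * a = Jm by rewrite -expr2 sqr_sqrtr // ltW.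
set kappa := k / Jm in hL.
have kE : k = a * a * kappa by rewrite /kappa aa mulrC divfK // gt_eqF.
have ka0 : 0 <= kappa by rewrite divr_ge0 // ltW.
have -> : s / a * (k * m) = a / 2 * (2 * kappa * s * m).
  by rewrite kE; field; rewrite gt_eqF.
rewrite ler_pM2l; last by rewrite divr_gt0.
have hL' : s * (1 + kappa * (1 + 2 * kappa)) <= L by rewrite /kappa mulrA.
have h : 2 * kappa * s <= L - s / 2.
  have : 0 <= s * (1 / 2 - kappa + 2 * kappa ^+ 2).
    by rewrite mulr_ge0 //; nra.
  nra.
by apply: ler_pM => //; apply: mulr_ge0 => //; apply: mulr_ge0.
Qed.

(** Smoothing a norm weakens the damping by the gain times eps. The common bound [L] of the gains
    appears only in that defect. *)
Lemma lyapunov_rate (Jm JM k1 k2 oM eps L n q m1 m2 s L1 L2 D D1 D2 : K) :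
  0 < Jm -> 0 < eps -> 0 < oM -> 0 < k1 -> 0 < k2 ->
  0 <= n -> 0 <= m1 -> 0 <= m2 -> n <= s -> oM <= s ->
  Jm * n ^+ 2 <= q -> q <= JM * n ^+ 2 ->
  s * (1 + k1 / Jm * (1 + 2 * k1 / Jm)) <= L1 -> L1 <= L ->
  s * (1 + k2 / Jm * (1 + 2 * k2 / Jm)) <= L2 -> L2 <= L ->
  D <= - (3 / 2 * JM * n ^+ 2) + n ^+ 2 * (k1 * m1 + k2 * m2) ->
  D1 <= m1 * n - L1 * m1 ^+ 2 -> D2 <= m2 * n - L2 * m2 ^+ 2 ->
  let a := Num.sqrt Jm in
  let W := Num.sqrt (q + eps ^+ 2) in
  let N1 := Num.sqrt (m1 ^+ 2 + eps ^+ 2) in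
  let N2 := Num.sqrt (m2 ^+ 2 + eps ^+ 2) in
  D / W + a / 2 * (D1 / N1 + D2 / N2) <=
    - (Num.min (1 / 2) (oM / 2) * (W + a / 2 * (N1 + N2))) + (3 / 2 + a * L) * eps.
Proof.
move=> Jm0 e0 oM0 k10 k20 n0 m10 m20 ns oMs Jq qJ hL1 L1L hL2 L2L hD hD1 hD2 /=.
set a := Num.sqrt Jm; set W := Num.sqrt (q + _).
set N1 := Num.sqrt (m1 ^+ 2 + _); set N2 := Num.sqrt (m2 ^+ 2 + _).
have q0 : 0 <= q by apply: le_trans Jq; rewrite mulr_ge0 ?sqr_ge0 ?ltW.
have s0 : 0 <= s by apply: le_trans oMs; exact: ltW.
have a0 : 0 < a by rewrite sqrtr_gt0.
have gain0 (k : K) : 0 < k -> 0 <= s * (1 + k / Jm * (1 + 2 * k / Jm)).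
  move=> k0; have kJ : 0 <= k / Jm by rewrite divr_ge0 ?ltW.
  by rewrite mulr_ge0 // addr_ge0 // mulr_ge0 // addr_ge0 // -mulrA mulr_ge0.
have L10 := le_trans (gain0 _ k10) hL1.
have L20 := le_trans (gain0 _ k20) hL2.
have km0 : 0 <= k1 * m1 + k2 * m2 by rewrite addr_ge0 // mulr_ge0 // ltW.
have := kinetic_rate Jm0 e0 n0 ns km0 Jq qJ hD; rewrite /= -/W -/a => hW.
have := output_rate e0 n0 m10 L10 hD1; rewrite /= -/N1 => hN1.
have := output_rate e0 n0 m20 L20 hD2; rewrite /= -/N2 => hN2.
have [W0 _ _ qW _] := smoothed_norm_bounds q0 e0; rewrite -/W in W0 qW.
have [N10 _ _ mN1 _] := smoothed_norm_bounds (sqr_ge0 m1) e0.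
have [N20 _ _ mN2 _] := smoothed_norm_bounds (sqr_ge0 m2) e0.
rewrite -/N1 sqrtr_sqr ger0_norm // in N10 mN1.
rewrite -/N2 sqrtr_sqr ger0_norm // in N20 mN2.
have anW : a * n <= W.
  apply: le_trans qW; rewrite -[n]ger0_norm // -sqrtr_sqr /a -sqrtrM ?(ltW Jm0) //.
  exact: ler_wsqrtr.
have g1 := gain_absorbs Jm0 s0 (ltW k10) m10 mN1 hL1.
have g2 := gain_absorbs Jm0 s0 (ltW k20) m20 mN2 hL2.
rewrite -/a in g1 g2.
set lam := Num.min _ _.
have lam1 : lam * W <= 1 / 2 * W by rewrite ler_pM2r // ge_min lexx.
have laN (N : K) : 0 < N -> lam * (a / 2 * N) <= a / 2 * (s / 2 * N).
  move=> N0; rewrite mulrCA ler_pM2l ?divr_gt0 // ler_pM2r //.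
  rewrite ge_min; apply/orP; right; lra.
have lN1 := laN _ N10; have lN2 := laN _ N20.
have hN1' : a / 2 * (D1 / N1) <= a / 2 * (n - L1 * N1 + L1 * eps).
  by rewrite ler_pM2l ?divr_gt0.
have hN2' : a / 2 * (D2 / N2) <= a / 2 * (n - L2 * N2 + L2 * eps).
  by rewrite ler_pM2l ?divr_gt0.
have e1 : a / 2 * (L1 * eps) <= a / 2 * (L * eps).
  by rewrite ler_pM2l ?divr_gt0 // ler_pM2r.
have e2 : a / 2 * (L2 * eps) <= a / 2 * (L * eps).
  by rewrite ler_pM2l ?divr_gt0 // ler_pM2r.
clear - hW hN1' hN2' anW g1 g2 lam1 lN1 lN2 e1 e2.
set A := D / W in hW *; set B1 := D1 / N1 in hN1' *; set B2 := D2 / N2 in hN2' *.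
set c := s / a in hW g1 g2.
nra.
Qed.

Lemma gronwall (f df : K -> K) (lam c a b : K) : 0 < lam -> a <= b ->
  (forall t, t \in `[a, b] -> has_deriv_within `[a, b] f t (df t)) ->
  (forall t, t \in `[a, b] -> df t <= - (lam * f t) + c) -> 0 <= c ->
  f b <= f a * expR (- lam * (b - a)) + c / lam.
Proof.
move=> lam0 ab fd dle c0.
pose E t := expR (lam * t).
have Ed t : has_deriv_within `[a, b] E t (lam * E t).
  apply: has_deriv_within_derive1.
  rewrite mulrC -[lam]mulr1.
  exact: is_derive1_comp (is_derive_expR _) (is_deriveZ lam (is_derive_id _ _)).
(* Subtracting the equilibrium [c / lam] makes the inequality homogeneous; the integrating factor
   then makes [g] nonincreasing. *)
pose g t := E t * (f t - c / lam).
have gd t : t \in `[a, b] ->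
    has_deriv_within `[a, b] g t (lam * E t * (f t - c / lam) + E t * (df t - 0)).
  move=> tab; apply: has_deriv_withinM => //.
  by apply: has_deriv_withinB; [exact: fd | exact: has_deriv_within_cst].
have : g b <= g a.
  apply: (has_deriv_within_nincr ab gd) => t tab.
  have E0 : 0 < E t by exact: expR_gt0.
  have -> : lam * E t * (f t - c / lam) + E t * (df t - 0) =
      E t * (lam * f t - c + df t) by field; rewrite gt_eqF.
  by rewrite pmulr_rle0 //; have := dle t tab; lra.
rewrite /g => h.
have E0 : 0 < E b by exact: expR_gt0.
have EE : expR (- lam * (b - a)) = E a / E b.
  by rewrite /E -expRN -expRD; congr expR; ring.
have h1 : f b - c / lam <= E a / E b * (f a - c / lam).
  by rewrite mulrAC ler_pdivlMr // mulrC.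
have Eab : 0 < E a / E b by rewrite divr_gt0 // expR_gt0.
have cl : 0 <= c / lam by rewrite divr_ge0 // ltW.
rewrite EE.
have := mulr_ge0 (ltW Eab) cl.
lra.
Qed.

End Lyapunov.

(** * Topology of column vectors and derivatives of bilinear operations *)

Section MatrixTopology.
Context {K : realType}.

Lemma cvg_mx (I : Type) (F : set_system I) {FF : Filter F} m n
    (f : I -> 'M[K]_(m, n)) (A : 'M[K]_(m, n)) :
  (forall i j, f x i j @[x --> F] --> A i j) -> f x @[x --> F] --> A.
Proof.
move=> fA; apply/cvgrPdist_lt => e e0.
have : \forall x \near F, forall ij : 'I_m * 'I_n, `|A ij.1 ij.2 - f x ij.1 ij.2| < e.
  apply: filter_forall => -[i j] /=.
  by have /cvgrPdist_lt/(_ e e0) := fA i j.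
apply: filterS => x fx.
rewrite [ltLHS]/Num.Def.normr /= mx_normrE; apply/bigmax_ltP; split=> // ij _.
by rewrite !mxE.
Qed.

Lemma cvg_entry (I : Type) (F : set_system I) {FF : Filter F} m n (f : I -> 'M[K]_(m, n))
    (A : 'M[K]_(m, n)) i j :
  f x @[x --> F] --> A -> f x i j @[x --> F] --> A i j.
Proof. by exact: (continuous_cvg _ (@coord_continuous K m n i j A)). Qed.

Lemma cvg_cross (I : Type) (F : set_system I) {FF : Filter F} (f g : I -> 'cV[K]_3)
    (a b : 'cV[K]_3) :
  f x @[x --> F] --> a -> g x @[x --> F] --> b ->
  cross (f x) (g x) @[x --> F] --> cross a b.
Proof.
move=> fa gb; apply: cvg_mx => i j; rewrite mxE.
under eq_fun do rewrite mxE.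
by apply: cvgB; apply: cvgM; exact: cvg_entry.
Qed.

Lemma cvg_dot (I : Type) (F : set_system I) {FF : Filter F} (f g : I -> 'cV[K]_3)
    (a b : 'cV[K]_3) :
  f x @[x --> F] --> a -> g x @[x --> F] --> b ->
  dot (f x) (g x) @[x --> F] --> dot a b.
Proof.
move=> fa gb; rewrite /dot sum3.
under eq_fun do rewrite sum3.
by apply: cvgD; [apply: cvgD|]; apply: cvgM; exact: cvg_entry.
Qed.

Lemma cvg_mulmx3 (I : Type) (F : set_system I) {FF : Filter F}
    (A : 'M[K]_3) (f : I -> 'cV[K]_3) (a : 'cV[K]_3) :
  f x @[x --> F] --> a -> A *m f x @[x --> F] --> A *m a.
Proof.
move=> fa; apply: cvg_mx => i j; rewrite mxE sum3.
under eq_fun do rewrite mxE sum3.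
by apply: cvgD; [apply: cvgD|]; apply: cvgM; (exact: cvg_cst || exact: cvg_entry).
Qed.

(** Transposition is a continuous isometry, so compactness is transported from row vectors. *)
Lemma compact_closed_ball_cV n (M : K) : compact [set v : 'cV[K]_n | `|v| <= M].
Proof.
have nT (v : 'rV[K]_n) : `|v^T| <= M <-> `|v| <= M.
  rewrite /Num.Def.normr /= !mx_normrE.
  split=> /bigmax_leP[M0 h]; apply/bigmax_leP; split=> // -[i j] _ /=.
    by have := h (j, i) isT; rewrite mxE.
  by have := h (j, i) isT; rewrite mxE.
have -> : [set v : 'cV[K]_n | `|v| <= M] =
    [set v^T | v in [set v : 'rV[K]_n | `|v| <= M]].
  apply/seteqP; split=> [v vM|_ [v vM <-]]; last exact/nT.
  by exists v^T; [apply/nT; rewrite trmxK | rewrite trmxK].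
apply: continuous_compact.
  apply: continuous_subspaceT => v; apply: (@cvg_mx _ (nbhs v)) => i j.
  under eq_fun do rewrite mxE.
  by rewrite mxE; exact: coord_continuous.
apply: bounded_closed_compact.
  by exists M; split; [exact: num_real | move=> x Mx v vM; apply: le_trans vM (ltW Mx)].
have -> : [set v : 'rV[K]_n | `|v| <= M] = Num.norm @^-1` [set x | x <= M] by [].
by apply: closed_comp => [v _|]; [exact: norm_continuous | exact: closed_le].
Qed.

Lemma compact_closed_ball_prod (U V : normedModType K) :
  (forall M : K, compact [set v : U | `|v| <= M]) ->
  (forall M : K, compact [set v : V | `|v| <= M]) ->
  forall M : K, compact [set v : U * V | `|v| <= M].
Proof.
move=> cU cV M.
have -> : [set v : U * V | `|v| <= M] =
    [set v : U | `|v| <= M] `*` [set v : V | `|v| <= M].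
  by apply/seteqP; split=> -[u v] /=; rewrite prod_normE /= ge_max => /andP.
by apply: compact_setX.
Qed.

End MatrixTopology.

Section Derivatives.
Context {K : realType}.
Implicit Types (D : set K) (t : K).

Lemma has_deriv_within_cross D (f g : K -> 'cV[K]_3) t df dg :
  has_deriv_within D f t df -> has_deriv_within D g t dg ->
  has_deriv_within D (fun s => cross (f s) (g s)) t (cross df (g t) + cross (f t) dg).
Proof.
apply: (has_deriv_within_bilinear (B := @cross K)).
- by move=> c a b; exact: crossBl.
- by move=> c a b; exact: crossBr.
- by move=> *; exact: crossZl.
- by move=> *; exact: crossZr.
- by move=> p; apply: (@cvg_cross K _ (nbhs p)); [exact: cvg_fst | exact: cvg_snd].
Qed.

Lemma has_deriv_within_dot D (f g : K -> 'cV[K]_3) t df dg :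
  has_deriv_within D f t df -> has_deriv_within D g t dg ->
  has_deriv_within D (fun s => dot (f s) (g s)) t (dot df (g t) + dot (f t) dg).
Proof.
apply: (has_deriv_within_bilinear (W := K) (B := @dot K 3)).
- by move=> c a b; exact: dotBl.
- by move=> c a b; exact: dotBr.
- by move=> *; exact: dotZl.
- by move=> *; exact: dotZr.
- by move=> p; apply: (@cvg_dot K _ (nbhs p)); [exact: cvg_fst | exact: cvg_snd].
Qed.

Lemma has_deriv_within_mulmx D (A : 'M[K]_3) (f : K -> 'cV[K]_3) t df :
  has_deriv_within D f t df ->
  has_deriv_within D (fun s => A *m f s) t (A *m df).
Proof.
apply: (has_deriv_within_linear (L := mulmx A)).
- by move=> u v; exact: mulmxBr.
- by move=> a v; rewrite scalemxAr.
- by move=> v; apply: (@cvg_mulmx3 K _ (nbhs v)).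
Qed.

(** A row of R times [skew w], read as a column, is r x w, because u . (w x v) = (u x w) . v. *)
Lemma has_deriv_within_row_vec D (Rot : K -> 'M[K]_3) (w : 'cV[K]_3) t (i : 'I_3) :
  has_deriv_within D Rot t (Rot t *m skew w) ->
  has_deriv_within D (row_vec Rot i) t (cross (row_vec Rot i t) w).
Proof.
have -> : cross (row_vec Rot i t) w = (row i (Rot t *m skew w))^T.
  have triple (u v : 'cV[K]_3) : dot u (cross w v) = dot (cross u w) v.
    by rewrite /dot !sum3 !crossE; ring.
  apply/colP => a; rewrite [RHS]mxE [RHS]mxE.
  transitivity (dot (row_vec Rot i t) (cross w (delta_mx a 0))).
    rewrite triple /dot (bigD1 a) //= [delta_mx _ _ _ _]mxE !eqxx mulr1 big1 ?addr0 // => j ja.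
    by rewrite [delta_mx _ _ _ _]mxE (negbTE ja) mulr0.
  by rewrite [RHS]mxE; apply: eq_bigr => j _; rewrite !mxE.
apply: (has_deriv_within_linear (L := fun A : 'M[K]_3 => (row i A)^T)).
- by move=> A B; rewrite !linearB.
- by move=> a A; rewrite !linearZ.
- move=> A; apply: (@cvg_mx K _ (nbhs A)) => a b; rewrite !mxE.
  under eq_fun do rewrite !mxE.
  exact: coord_continuous.
Qed.

Lemma enorm_row_vec (Rot : K -> 'M[K]_3) t (i : 'I_3) : SO (Rot t) ->
  enorm (row_vec Rot i t) = 1.
Proof.
move=> [RR _]; rewrite enormE -dotE /row_vec trmxK.
have -> : (row i (Rot t) *m (row i (Rot t))^T) 0 0 = (Rot t *m (Rot t)^T) i i.
  by rewrite !mxE; apply: eq_bigr => j _; rewrite !mxE.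
by rewrite RR mxE eqxx sqrtr1.
Qed.

End Derivatives.

(** * Error dynamics *)

Section ErrorDynamics.
Context {K : realType} (J : 'M[K]_3) (Jm k1 k2 : K) (l1 l2 : 'cV[K]_3 -> K).
Hypotheses (J_sym : J^T = J) (Jm_gt0 : 0 < Jm) (J_ge : mx_ge J Jm%:M).

Definition error_state (r1 r2 w : 'cV[K]_3) (x : obs_state K) : obs_state K :=
  (omega_hat J k1 k2 r1 r2 x - w, x.1.2 - r1, x.2 - r2).

Definition state_of_error (r1 r2 w : 'cV[K]_3) (y : obs_state K) : obs_state K :=
  (w + y.1.1 + k1 *: (invmx J *m cross (y.1.2 + r1) r1)
     + k2 *: (invmx J *m cross (y.2 + r2) r2), y.1.2 + r1, y.2 + r2).

Definition error_field (r1 r2 w : 'cV[K]_3) (y : obs_state K) : obs_state K :=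
  (zfield J k1 k2 r1 r2 w y.1.1 y.1.2 y.2,
   efield l1 r1 w y.1.1 y.1.2, efield l2 r2 w y.1.1 y.2).

Lemma omega_hatE (r1 r2 : 'cV[K]_3) (x : obs_state K) :
  omega_hat J k1 k2 r1 r2 x =
  x.1.1 - k1 *: (invmx J *m cross x.1.2 r1) - k2 *: (invmx J *m cross x.2 r2).
Proof. by case: x => -[]. Qed.

Lemma error_stateK r1 r2 w (x : obs_state K) :
  state_of_error r1 r2 w (error_state r1 r2 w x) = x.
Proof.
rewrite /state_of_error /error_state /= !subrK omega_hatE.
case: x => -[xi rh1 rh2] /=; congr (_, _, _).
by rewrite [w + _]addrC subrK -addrA addrAC !addrA subrK addrK.
Qed.

Lemma state_of_errorK r1 r2 w (y : obs_state K) :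
  error_state r1 r2 w (state_of_error r1 r2 w y) = y.
Proof.
rewrite /state_of_error /error_state /= !addrK.
case: y => -[z e1 e2] /=; congr (_, _, _).
by rewrite [_ - k1 *: _]addrAC !addrK [w + z]addrC addrK.
Qed.

(** [observer_zfield] read backwards: the left-hand side is what differentiating [state_of_error]
    along an error solution produces. It turns a continuation of the error into one of the
    observer. *)
Lemma observer_field_of_error (r1 r2 w tau : 'cV[K]_3) (x : obs_state K) :
  let d := error_field r1 r2 w (error_state r1 r2 w x) in
  (invmx J *m (cross (J *m w) w + tau) + d.1.1
     + k1 *: (invmx J *m (cross (d.1.2 + cross r1 w) r1 + cross x.1.2 (cross r1 w)))
     + k2 *: (invmx J *m (cross (d.2 + cross r2 w) r2 + cross x.2 (cross r2 w))),
   d.1.2 + cross r1 w, d.2 + cross r2 w)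
  = observer_field J k1 k2 l1 l2 r1 r2 tau x.
Proof.
case: x => -[xi rh1] rh2; rewrite /error_state /error_field; cbv zeta.
have := observer_zfield J k1 k2 l1 l2 r1 r2 w tau xi rh1 rh2.
rewrite /observer_field; set wh := omega_hat _ _ _ _ _ _; cbv zeta.
rewrite /fst /snd => <-; rewrite -!observer_efield !subrK.
congr (_, _, _).
set A := k1 *: (_ *m (cross _ _ + _)); set B := k2 *: (_ *m (cross _ _ + _)).
set C := invmx J *m (_ + tau).
by rewrite [C + _]addrC subrK [X in X + _]addrAC !subrK.
Qed.

Section Trajectory.
Variables (D : set K) (t : K) (r1 r2 w : K -> 'cV[K]_3) (dw tau : 'cV[K]_3).
Hypotheses (r1d : has_deriv_within D r1 t (cross (r1 t) (w t))).
Hypotheses (r2d : has_deriv_within D r2 t (cross (r2 t) (w t))).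
Hypotheses (wd : has_deriv_within D w t dw).
Hypothesis (Jdw : J *m dw = cross (J *m w t) (w t) + tau).

Let dwE : dw = invmx J *m (cross (J *m w t) (w t) + tau).
Proof. by rewrite -Jdw mulmxA mulVmx ?mul1mx // (inertia_unit J_sym Jm_gt0 J_ge). Qed.

Lemma has_deriv_within_error_state (x : K -> obs_state K) :
  has_deriv_within D x t (observer_field J k1 k2 l1 l2 (r1 t) (r2 t) tau (x t)) ->
  has_deriv_within D (fun s => error_state (r1 s) (r2 s) (w s) (x s)) t
    (error_field (r1 t) (r2 t) (w t) (error_state (r1 t) (r2 t) (w t) (x t))).
Proof.
move=> xd.
have x1d := has_deriv_within_fst xd; have x2d := has_deriv_within_snd xd.
have x11d := has_deriv_within_fst x1d; have x12d := has_deriv_within_snd x1d.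
have := has_deriv_within_pair (has_deriv_within_pair
  (has_deriv_withinB (has_deriv_withinB (has_deriv_withinB x11d
    (has_deriv_withinZ (a := k1) (has_deriv_within_mulmx (A := invmx J)
      (has_deriv_within_cross x12d r1d))))
    (has_deriv_withinZ (a := k2) (has_deriv_within_mulmx (A := invmx J)
      (has_deriv_within_cross x2d r2d)))) wd)
  (has_deriv_withinB x12d r1d)) (has_deriv_withinB x2d r2d).
rewrite /error_state; under [in X in _ -> X]eq_fun do rewrite omega_hatE.
move=> H; apply: (eq_has_deriv_within H); rewrite dwE /error_field /=.
move: (x t) => -[[xi rh1] rh2].
have /= -> := observer_zfield J k1 k2 l1 l2 (r1 t) (r2 t) (w t) tau xi rh1 rh2.
by rewrite /= !observer_efield.
Qed.

Lemma has_deriv_within_state_of_error (y : K -> obs_state K) :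
  has_deriv_within D y t (error_field (r1 t) (r2 t) (w t) (y t)) ->
  let x := fun s => state_of_error (r1 s) (r2 s) (w s) (y s) in
  has_deriv_within D x t (observer_field J k1 k2 l1 l2 (r1 t) (r2 t) tau (x t)).
Proof.
move=> yd x.
have y1d := has_deriv_within_fst yd; have y2d := has_deriv_within_snd yd.
have y11d := has_deriv_within_fst y1d; have y12d := has_deriv_within_snd y1d.
have rh1d := has_deriv_withinD y12d r1d; have rh2d := has_deriv_withinD y2d r2d.
have ytE : y t = error_state (r1 t) (r2 t) (w t) (x t) by rewrite state_of_errorK.
have := has_deriv_within_pair (has_deriv_within_pair (has_deriv_withinD (has_deriv_withinD
  (has_deriv_withinD wd y11d)
    (has_deriv_withinZ (a := k1) (has_deriv_within_mulmx (A := invmx J)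
      (has_deriv_within_cross rh1d r1d))))
    (has_deriv_withinZ (a := k2) (has_deriv_within_mulmx (A := invmx J)
      (has_deriv_within_cross rh2d r2d))))
  rh1d) rh2d.
move=> H; apply: (eq_has_deriv_within H).
by rewrite -(observer_field_of_error (r1 t) (r2 t) (w t)) -ytE dwE.
Qed.

End Trajectory.
End ErrorDynamics.

(** * Exponential decay of the error *)

Section Decay.
Context {K : realType} (J : 'M[K]_3) (Jm JM omegaM k1 k2 : K).
Variables (l1 l2 : 'cV[K]_3 -> K).
Hypotheses (J_sym : J^T = J) (Jm_gt0 : 0 < Jm).
Hypotheses (J_ge : mx_ge J Jm%:M) (J_le : mx_ge JM%:M J).
Hypotheses (omegaM_gt0 : 0 < omegaM) (k1_gt0 : 0 < k1) (k2_gt0 : 0 < k2).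
Hypotheses (l1_cont : continuous l1) (l2_cont : continuous l2).
Hypothesis l1_gain : forall wh : 'cV[K]_3,
  (enorm wh + omegaM) * (1 + k1 / Jm * (1 + 2 * k1 / Jm)) < l1 wh.
Hypothesis l2_gain : forall wh : 'cV[K]_3,
  (enorm wh + omegaM) * (1 + k2 / Jm * (1 + 2 * k2 / Jm)) < l2 wh.

Definition smooth_energy (eps : K) (y : obs_state K) : K :=
  Num.sqrt (dot y.1.1 (J *m y.1.1) + eps ^+ 2) +
  Num.sqrt Jm / 2 * (Num.sqrt (enorm y.1.2 ^+ 2 + eps ^+ 2) +
                     Num.sqrt (enorm y.2 ^+ 2 + eps ^+ 2)).

Definition energy (y : obs_state K) : K :=
  Num.sqrt (dot y.1.1 (J *m y.1.1)) + Num.sqrt Jm / 2 * (enorm y.1.2 + enorm y.2).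

Definition error_norm (y : obs_state K) : K :=
  enorm (col_mx y.1.1 (col_mx y.1.2 y.2)).

Lemma kinetic_ge0 (z : 'cV[K]_3) : 0 <= dot z (J *m z).
Proof. by apply: le_trans (inertia_ge J_ge z); rewrite mulr_ge0 ?sqr_ge0 // ltW. Qed.

Lemma sqrt_Jm_gt0 : 0 < Num.sqrt Jm. Proof. by rewrite sqrtr_gt0. Qed.

Lemma energy_le_smooth eps y : 0 < eps -> energy y <= smooth_energy eps y.
Proof.
move=> e0; have a0 := sqrt_Jm_gt0.
have [_ _ _ h0 _] := smoothed_norm_bounds (kinetic_ge0 y.1.1) e0.
have [_ _ _ h1 _] := smoothed_norm_bounds (sqr_ge0 (enorm y.1.2)) e0.
have [_ _ _ h2 _] := smoothed_norm_bounds (sqr_ge0 (enorm y.2)) e0.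
rewrite sqrtr_sqr ger0_norm ?enorm_ge0 // in h1.
rewrite sqrtr_sqr ger0_norm ?enorm_ge0 // in h2.
by rewrite lerD // ler_pM2l ?divr_gt0 // lerD.
Qed.

Lemma smooth_energy_le eps y : 0 < eps ->
  smooth_energy eps y <= energy y + (1 + Num.sqrt Jm) * eps.
Proof.
move=> e0; have a0 := sqrt_Jm_gt0.
have [_ _ _ _ h0] := smoothed_norm_bounds (kinetic_ge0 y.1.1) e0.
have [_ _ _ _ h1] := smoothed_norm_bounds (sqr_ge0 (enorm y.1.2)) e0.
have [_ _ _ _ h2] := smoothed_norm_bounds (sqr_ge0 (enorm y.2)) e0.
rewrite sqrtr_sqr ger0_norm ?enorm_ge0 // in h1.
rewrite sqrtr_sqr ger0_norm ?enorm_ge0 // in h2.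
have := lerD h1 h2; rewrite -(ler_pM2l (divr_gt0 a0 (ltr0n K 2))) => h12.
apply: le_trans (lerD h0 h12) _; rewrite /energy.
lra.
Qed.

(** As [J] is symmetric, the two terms of the product rule for z . J z coincide and cancel the 2
    from the square root. *)
Lemma has_deriv_within_smooth_energy (D : set K) (y : K -> obs_state K) t
    (dy : obs_state K) (eps : K) : 0 < eps -> has_deriv_within D y t dy ->
  has_deriv_within D (fun s => smooth_energy eps (y s)) t
    (dot (y t).1.1 (J *m dy.1.1) / Num.sqrt (dot (y t).1.1 (J *m (y t).1.1) + eps ^+ 2) +
     Num.sqrt Jm / 2 *
      (dot (y t).1.2 dy.1.2 / Num.sqrt (enorm (y t).1.2 ^+ 2 + eps ^+ 2) +
       dot (y t).2 dy.2 / Num.sqrt (enorm (y t).2 ^+ 2 + eps ^+ 2))).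
Proof.
move=> e0 yd; have e2 : 0 < eps ^+ 2 by rewrite exprn_gt0.
have y1d := has_deriv_within_fst yd; have y2d := has_deriv_within_snd yd.
have zd := has_deriv_within_fst y1d; have e1d := has_deriv_within_snd y1d.
have half (x v : K) : (x + x) / (2 * v) = x / v.
  by rewrite -mulr2n -[x *+ 2]mulr_natl -mulf_div divff ?mul1r.
have normd (e : K -> 'cV[K]_3) (de : 'cV[K]_3) : has_deriv_within D e t de ->
    has_deriv_within D (fun s => Num.sqrt (enorm (e s) ^+ 2 + eps ^+ 2)) t
      (dot (e t) de / Num.sqrt (enorm (e t) ^+ 2 + eps ^+ 2)).
  move=> ed.
  apply: (eq_has_deriv_within (d := (dot de (e t) + dot (e t) de + 0) /
      (2 * Num.sqrt (enorm (e t) ^+ 2 + eps ^+ 2)))).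
    apply: (has_deriv_within_sqrt (f := fun s => enorm (e s) ^+ 2 + eps ^+ 2)).
      by move=> s; rewrite ltr_wpDl // sqr_ge0.
    under eq_fun do rewrite enorm_sqr.
    by apply: has_deriv_withinD (has_deriv_within_cst _ _ _); exact: has_deriv_within_dot.
  by rewrite addr0 (dotC de) half.
apply: has_deriv_withinD; last first.
  by apply: has_deriv_withinZ; apply: has_deriv_withinD; exact: normd.
apply: (eq_has_deriv_within (d := (dot dy.1.1 (J *m (y t).1.1) +
    dot (y t).1.1 (J *m dy.1.1) + 0) /
    (2 * Num.sqrt (dot (y t).1.1 (J *m (y t).1.1) + eps ^+ 2)))).
  apply: (has_deriv_within_sqrt (f := fun s => dot (y s).1.1 (J *m (y s).1.1) + eps ^+ 2)).
    by move=> s; rewrite ltr_wpDl // kinetic_ge0.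
  apply: has_deriv_withinD (has_deriv_within_cst _ _ _).
  by apply: has_deriv_within_dot => //; exact: has_deriv_within_mulmx.
by rewrite addr0 dot_mulmx J_sym (dotC (J *m _)) half.
Qed.

Definition decay_rate : K := Num.min (1 / 2) (omegaM / 2).

Lemma decay_rate_gt0 : 0 < decay_rate.
Proof. by rewrite lt_min !divr_gt0. Qed.

Lemma energy_decay (r1 r2 w : K -> 'cV[K]_3) (y : K -> obs_state K) (t0 u : K) :
  t0 <= u ->
  (forall t, t \in `[t0, u] -> [/\ enorm (r1 t) = 1, enorm (r2 t) = 1,
     enorm (w t) <= omegaM &
     mx_gt (- (k1 *: (skew (r1 t) *m skew (r1 t))) - k2 *: (skew (r2 t) *m skew (r2 t)))
           (JM * (omegaM + 3 / 2))%:M]) ->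
  {within `[t0, u], continuous w} ->
  (forall t, t \in `[t0, u] -> has_deriv_within `[t0, u] y t
     (error_field J k1 k2 l1 l2 (r1 t) (r2 t) (w t) (y t))) ->
  energy (y u) <= energy (y t0) * expR (- decay_rate * (u - t0)).
Proof.
move=> t0u traj wc yd; have lam0 := decay_rate_gt0.
have a0 := sqrt_Jm_gt0; set a := Num.sqrt Jm in a0.
have whc : {within `[t0, u], continuous (fun t => w t + (y t).1.1)}.
  apply/subspace_continuousP => t tt; apply: cvgD.
    by move/subspace_continuousP: wc => /(_ t tt).
  apply: (has_deriv_within_continuous (has_deriv_within_fst (has_deriv_within_fst (yd t _)))).
  exact: tt.
(* The gains are bounded along the solution because the velocity estimate is continuous on a compact
   segment. *)
have bnd (l : 'cV[K]_3 -> K) : continuous l ->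
    exists L, forall t, t \in `[t0, u] -> l (w t + (y t).1.1) <= L.
  move=> lc; have [|c _ hc] := @EVT_max K (fun t => l (w t + (y t).1.1)) t0 u t0u.
    apply/subspace_continuousP => t tt; apply: (continuous_cvg _ (lc _)).
    by move/subspace_continuousP: whc => /(_ t tt).
  by exists (l (w c + (y c).1.1)).
have [L1 hL1] := bnd l1 l1_cont; have [L2 hL2] := bnd l2 l2_cont.
pose L := Num.max 0 (Num.max L1 L2).
have L0 : 0 <= L by rewrite le_max lexx.
(* Sum of all coefficients of eps: [1 + a] from replacing the smoothed energy by [energy] at [t0],
   the rest from Gronwall's lemma. The choice [eps = q / c] makes the total defect at most [q]. *)
pose c := 1 + a + (3 / 2 + a * L) / decay_rate.
have c0 : 0 < c.
  by rewrite ltr_pwDl ?addr_gt0 // divr_ge0 ?(ltW lam0) // addr_ge0 ?mulr_ge0 // ltW.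
apply/ler_addgt0Pl => q q0.
pose eps := q / c; have e0 : 0 < eps by rewrite divr_gt0.
have step : smooth_energy eps (y u) <=
    smooth_energy eps (y t0) * expR (- decay_rate * (u - t0)) +
    (3 / 2 + a * L) * eps / decay_rate.
  apply: (gronwall lam0 t0u (fun t tt => has_deriv_within_smooth_energy e0 (yd t tt))).
    move=> t tt; have [r11 r21 wM gain] := traj t tt.
    rewrite /error_field /=; move: (y t) (hL1 t tt) (hL2 t tt) => -[[z e1] e2] /= z1 z2.
    apply: (lyapunov_rate (JM := JM) (s := enorm (w t + z) + omegaM) (n := enorm z)
      (L1 := l1 (w t + z)) (L2 := l2 (w t + z)) Jm_gt0 e0 omegaM_gt0 k1_gt0 k2_gt0).
    - exact: enorm_ge0.
    - exact: enorm_ge0.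
    - exact: enorm_ge0.
    - have -> : z = (w t + z) - w t by rewrite addrC addKr.
      rewrite {2}[w t + z - w t]addrC addKr.
      by apply: le_trans (enormB_le _ _) _; rewrite lerD2l.
    - by rewrite lerDr enorm_ge0.
    - exact: inertia_ge.
    - exact: inertia_le.
    - exact/ltW/l1_gain.
    - by rewrite !le_max z1 orbT.
    - exact/ltW/l2_gain.
    - by rewrite !le_max z2 !orbT.
    - exact: (dot_zfield_le J_sym Jm_gt0 J_ge J_le k1_gt0 k2_gt0 z e1 e2 r11 r21 wM gain).
    - exact: dot_efield_le.
    - exact: dot_efield_le.
  apply: mulr_ge0 (ltW e0); apply: addr_ge0 (mulr_ge0 (ltW a0) L0).
  exact: divr_ge0 (ler0n _ 3) (ler0n _ 2).
set E := expR _ in step *.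
have E0 : 0 <= E by exact: expR_ge0.
have E1 : E <= 1.
  by rewrite -expR0 ler_expR mulNr oppr_le0 mulr_ge0 ?subr_ge0 // ltW.
have h1 := energy_le_smooth (y u) e0.
have h2 := ler_wpM2r E0 (smooth_energy_le (y t0) e0).
rewrite -/a in h2.
have h3 : (1 + a) * eps * E <= (1 + a) * eps.
  by rewrite ler_piMr // mulr_ge0 ?addr_ge0 ?(ltW e0) ?(ltW a0).
have h4 : q = (1 + a) * eps + (3 / 2 + a * L) * eps / decay_rate.
  transitivity (eps * c); last by rewrite /c; ring.
  by rewrite /eps divfK // gt_eqF.
rewrite h4; lra.
Qed.

Lemma error_norm_ge0 y : 0 <= error_norm y. Proof. exact: enorm_ge0. Qed.

Lemma error_norm_sqr y :
  error_norm y ^+ 2 = enorm y.1.1 ^+ 2 + (enorm y.1.2 ^+ 2 + enorm y.2 ^+ 2).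
Proof. by rewrite /error_norm !enorm_col_mx. Qed.

Lemma error_norm_components y :
  [/\ enorm y.1.1 <= error_norm y, enorm y.1.2 <= error_norm y & enorm y.2 <= error_norm y].
Proof.
have h := error_norm_sqr y.
have n0 := sqr_ge0 (enorm y.1.1); have n1 := sqr_ge0 (enorm y.1.2).
have n2 := sqr_ge0 (enorm y.2).
by split; rewrite -(@ler_pXn2r _ 2) ?nnegrE ?enorm_ge0 ?error_norm_ge0 // h; lra.
Qed.

(** The factor 2 compensates the weight sqrt Jm / 2 of the output errors; the kinetic part alone
    would need only 1 / sqrt Jm. *)
Lemma error_norm_le_energy y : error_norm y <= 2 / Num.sqrt Jm * energy y.
Proof.
have a0 := sqrt_Jm_gt0; set a := Num.sqrt Jm in a0 *.
have [z0 e10 e20] : [/\ 0 <= enorm y.1.1, 0 <= enorm y.1.2 & 0 <= enorm y.2].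
  by split; exact: enorm_ge0.
have h1 : error_norm y <= enorm y.1.1 + enorm y.1.2 + enorm y.2.
  rewrite -(@ler_pXn2r _ 2) ?nnegrE ?error_norm_ge0 ?addr_ge0 //.
  rewrite error_norm_sqr; nra.
apply: le_trans h1 _.
have h2 : a * enorm y.1.1 <= Num.sqrt (dot y.1.1 (J *m y.1.1)).
  rewrite -[enorm y.1.1]ger0_norm // -sqrtr_sqr /a -sqrtrM ?(ltW Jm_gt0) //.
  by apply: ler_wsqrtr; exact: inertia_ge.
rewrite /energy -/a.
have -> : 2 / a * (Num.sqrt (dot y.1.1 (J *m y.1.1)) + a / 2 * (enorm y.1.2 + enorm y.2))
    = 2 * (Num.sqrt (dot y.1.1 (J *m y.1.1)) / a) + (enorm y.1.2 + enorm y.2).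
  by field; rewrite gt_eqF.
have : enorm y.1.1 <= Num.sqrt (dot y.1.1 (J *m y.1.1)) / a by rewrite ler_pdivlMr // mulrC.
lra.
Qed.

Lemma energy_le_error_norm y : energy y <= (Num.sqrt JM + Num.sqrt Jm) * error_norm y.
Proof.
have a0 := sqrt_Jm_gt0; set a := Num.sqrt Jm in a0 *.
have JM0 := inertia_max_gt0 Jm_gt0 J_ge J_le.
have [h0 h1 h2] := error_norm_components y.
have hz : Num.sqrt (dot y.1.1 (J *m y.1.1)) <= Num.sqrt JM * error_norm y.
  rewrite -[error_norm y]ger0_norm ?error_norm_ge0 // -sqrtr_sqr -sqrtrM ?(ltW JM0) //.
  apply: ler_wsqrtr; apply: le_trans (inertia_le J_le _) _.
  by rewrite ler_pM2l // ler_pXn2r ?nnegrE ?enorm_ge0 // error_norm_ge0.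
have h12 : a / 2 * (enorm y.1.2 + enorm y.2) <= a / 2 * (error_norm y + error_norm y).
  by rewrite ler_pM2l ?divr_gt0 // lerD.
rewrite /energy -/a; lra.
Qed.

(** Continuation is phrased in the norm of the product space, a maximum of sup norms; this transfers
    the Euclidean decay bound to it. *)
Lemma normr_le_error_norm y : `|y| <= error_norm y.
Proof.
have [h0 h1 h2] := error_norm_components y.
rewrite [leLHS]prod_normE ge_max; apply/andP; split; last first.
  exact: le_trans (normr_le_enorm _) h2.
rewrite [leLHS]prod_normE ge_max.
by rewrite (le_trans (normr_le_enorm _) h0) (le_trans (normr_le_enorm _) h1).
Qed.

Lemma error_field_continuous (r1 r2 w : K -> 'cV[K]_3) (t : K) (y : obs_state K) :
  {for t, continuous r1} -> {for t, continuous r2} -> {for t, continuous w} ->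
  {for (t, y), continuous (fun p : K * obs_state K =>
     error_field J k1 k2 l1 l2 (r1 p.1) (r2 p.1) (w p.1) p.2)}.
Proof.
move=> r1c r2c wc; set F := nbhs (t, y).
have pt : p.1 @[p --> F] --> t by exact: cvg_fst.
have py : p.2 @[p --> F] --> y by exact: cvg_snd.
have r1t : r1 p.1 @[p --> F] --> r1 t by apply: cvg_comp pt r1c.
have r2t : r2 p.1 @[p --> F] --> r2 t by apply: cvg_comp pt r2c.
have wt : w p.1 @[p --> F] --> w t by apply: cvg_comp pt wc.
have y1 : p.2.1 @[p --> F] --> y.1 by apply: cvg_comp py _; exact: cvg_fst.
have e2t : p.2.2 @[p --> F] --> y.2 by apply: cvg_comp py _; exact: cvg_snd.
have zt : p.2.1.1 @[p --> F] --> y.1.1 by apply: cvg_comp y1 _; exact: cvg_fst.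
have e1t : p.2.1.2 @[p --> F] --> y.1.2 by apply: cvg_comp y1 _; exact: cvg_snd.
have wht : w p.1 + p.2.1.1 @[p --> F] --> w t + y.1.1 by exact: cvgD.
have ecv (l : 'cV[K]_3 -> K) (r e : K * obs_state K -> 'cV[K]_3) (r0 e0 : 'cV[K]_3) :
    continuous l -> r p @[p --> F] --> r0 -> e p @[p --> F] --> e0 ->
    efield l (r p) (w p.1) p.2.1.1 (e p) @[p --> F] --> efield l r0 (w t) y.1.1 e0.
  move=> lc rt et; apply: cvgB.
    by apply: cvgD; [exact: cvg_cross et wht | exact: cvg_cross rt zt].
  by apply: cvgZ => //; exact: (cvg_comp _ _ wht (lc _)).
have zcv : zfield J k1 k2 (r1 p.1) (r2 p.1) (w p.1) p.2.1.1 p.2.1.2 p.2.2 @[p --> F] -->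
    zfield J k1 k2 (r1 t) (r2 t) (w t) y.1.1 y.1.2 y.2.
  apply: cvg_mulmx3; apply: cvgB; last by apply: cvg_cross => //; exact: cvg_mulmx3.
  apply: cvgD; last by apply: cvg_cross => //; exact: cvg_mulmx3.
  apply: cvgD; apply: cvgZl_tmp; apply: cvg_cross; try exact: cvgD; exact: cvg_cross.
exact: cvg_pair (cvg_pair zcv (ecv _ _ _ _ _ l1_cont r1t e1t))
  (ecv _ _ _ _ _ l2_cont r2t e2t).
Qed.

End Decay.

(** * Uniform decay and global existence of observer solutions *)

Lemma enorm_est_error (K : realType) (J : 'M[K]_3) (k1 k2 : K) (r1 r2 w : 'cV[K]_3)
    (x : obs_state K) :
  enorm (est_error J k1 k2 r1 r2 w x) = error_norm (error_state J k1 k2 r1 r2 w x).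
Proof. by case: x => -[]. Qed.

Lemma compact_closed_ball_obs_state (K : realType) (M : K) :
  compact [set y : obs_state K | `|y| <= M].
Proof.
apply: compact_closed_ball_prod; last exact: compact_closed_ball_cV.
by apply: compact_closed_ball_prod; exact: compact_closed_ball_cV.
Qed.

Theorem mainTheorem1 (K : realType) (J : 'M[K]_3) (Jm JM omegaM k1 k2 : K)
    (l1 l2 : 'cV[K]_3 -> K)
    (J_sym : J^T = J) (Jm_gt0 : 0 < Jm) (Jm_le_JM : Jm <= JM)
    (J_ge : mx_ge J Jm%:M) (J_le : mx_ge JM%:M J)
    (omegaM_gt0 : 0 < omegaM) (k1_gt0 : 0 < k1) (k2_gt0 : 0 < k2)
    (l1_cont : continuous l1) (l2_cont : continuous l2)
    (l1_gain : forall wh : 'cV[K]_3,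
       (enorm wh + omegaM) * (1 + k1 / Jm * (1 + 2 * k1 / Jm)) < l1 wh)
    (l2_gain : forall wh : 'cV[K]_3,
       (enorm wh + omegaM) * (1 + k2 / Jm * (1 + 2 * k2 / Jm)) < l2 wh) :
  uniformly_global_exponential_observer J k1 k2 l1 l2
    (fun (Rot : K -> 'M[K]_3) (omega : K -> 'cV[K]_3) =>
       (forall t, 0 <= t -> enorm (omega t) <= omegaM) /\
       (forall t, 0 <= t ->
          mx_gt (- (k1 *: (skew (row_vec Rot 0 t) *m skew (row_vec Rot 0 t)))
                 - k2 *: (skew (row_vec Rot 1 t) *m skew (row_vec Rot 1 t)))
                (JM * (omegaM + 3 / 2))%:M)).
Proof.
have a0 : 0 < Num.sqrt Jm by rewrite sqrtr_gt0.
have lam0 := decay_rate_gt0 omegaM_gt0.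
have C0 : 0 < 2 / Num.sqrt Jm * (Num.sqrt JM + Num.sqrt Jm).
  by rewrite mulr_gt0 ?divr_gt0 // ltr_wpDl ?sqrtr_ge0.
exists (2 / Num.sqrt Jm * (Num.sqrt JM + Num.sqrt Jm)), (decay_rate omegaM).
split=> // Rot omega tau traj [wM gain] r1 r2 F err t0 T x t00.
have domP t : 0 <= t -> time_dom 0 +oo%E t by move=> tge0; split; rewrite ?ltry.
have r1d t : 0 <= t -> has_deriv_within (time_dom 0 +oo%E) r1 t (cross (r1 t) (omega t)).
  by move=> /traj[_ Rd _]; exact: has_deriv_within_row_vec.
have r2d t : 0 <= t -> has_deriv_within (time_dom 0 +oo%E) r2 t (cross (r2 t) (omega t)).
  by move=> /traj[_ Rd _]; exact: has_deriv_within_row_vec.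
have wd t : 0 <= t -> exists2 dw, has_deriv_within (time_dom 0 +oo%E) omega t dw &
    J *m dw = cross (J *m omega t) (omega t) + tau t.
  by move=> /traj[_ _ [dw [wd Jdw]]]; exists dw.
have conds t : 0 <= t -> [/\ enorm (r1 t) = 1, enorm (r2 t) = 1,
     enorm (omega t) <= omegaM &
     mx_gt (- (k1 *: (skew (r1 t) *m skew (r1 t))) - k2 *: (skew (r2 t) *m skew (r2 t)))
           (JM * (omegaM + 3 / 2))%:M].
  move=> tge0; have [SOt _ _] := traj t tge0.
  by split; [exact: enorm_row_vec | exact: enorm_row_vec | exact: wM | exact: gain].
pose G t := error_field J k1 k2 l1 l2 (r1 t) (r2 t) (omega t).
pose y s := error_state J k1 k2 (r1 s) (r2 s) (omega s) (x s).
have yd : solution F t0 T x -> forall t, time_dom t0 T t ->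
    has_deriv_within (time_dom t0 T) y t (G t (y t)).
  move=> [_ xd] t tT; have tge0 : 0 <= t by apply: le_trans t00 _; case: tT.
  have sub : time_dom t0 T `<=` time_dom 0 +oo%E.
    by move=> s [t0s _]; apply: domP; exact: le_trans t0s.
  have [dw wdt Jdw] := wd t tge0.
  apply: (has_deriv_within_error_state J_sym Jm_gt0 J_ge _ _ _ Jdw (xd t tT)).
  - exact: has_deriv_within_subset sub (r1d t tge0).
  - exact: has_deriv_within_subset sub (r2d t tge0).
  - exact: has_deriv_within_subset sub wdt.
have decay : solution F t0 T x -> forall t, time_dom t0 T t ->
    error_norm (y t) <= 2 / Num.sqrt Jm * (Num.sqrt JM + Num.sqrt Jm) *
      error_norm (y t0) * expR (- decay_rate omegaM * (t - t0)).
  move=> sol t [t0t tT].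
  have pos s : s \in `[t0, t] -> 0 <= s.
    by rewrite in_itv /= => /andP[t0s _]; exact: le_trans t0s.
  have dec : energy J Jm (y t) <= energy J Jm (y t0) * expR (- decay_rate omegaM * (t - t0)).
    apply: (energy_decay J_sym Jm_gt0 J_ge J_le omegaM_gt0 k1_gt0 k2_gt0 l1_cont l2_cont
      l1_gain l2_gain (r1 := r1) (r2 := r2) (w := omega) t0t).
  - by move=> s /pos; exact: conds.
  - apply/subspace_continuousP => s /= st; have [dw wds _] := wd s (pos s st).
    apply: has_deriv_within_continuous; apply: has_deriv_within_subset wds.
    by move=> v /= /pos; exact: domP.
  - move=> s st; have sT : time_dom t0 T s.
      move: st; rewrite in_itv /= => /andP[t0s st]; split=> //.
      by apply: le_lt_trans tT; rewrite lee_fin.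
    apply: has_deriv_within_subset (yd sol s sT).
    move=> v /=; rewrite in_itv /= => /andP[t0v vt]; split=> //.
    by apply: le_lt_trans tT; rewrite lee_fin.
  apply: le_trans (error_norm_le_energy Jm_gt0 J_ge (y t)) _.
  rewrite -!mulrA ler_pM2l // ler_pM2l ?invr_gt0 // mulrA.
  apply: le_trans dec _; rewrite ler_wpM2r ?expR_ge0 //.
  exact: energy_le_error_norm.
split=> [sol t tT|[sol maxi]].
  by rewrite /err !enorm_est_error; exact: decay.
have [t0T _] := sol.
(* [-oo] contradicts [t0 < T] and [+oo] is the claim; a finite [T] is refuted by continuing the
   solution. *)
case: T t0T yd decay sol maxi => [T||//] t0T yd decay sol maxi; last by [].
rewrite lte_fin in t0T; exfalso.
(* At time 0 the trajectory is only continuous from the right. Starting at a positive time provides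
   the two-sided continuity that [solution_extension] asks for. *)
pose s0 := (t0 + T) / 2.
have s00 : 0 < s0 by rewrite /s0; lra.
have t0s0 : t0 < s0 by rewrite /s0; lra.
have s0T : s0 < T by rewrite /s0; lra.
have dom s : t0 <= s -> s < T -> time_dom t0 T%:E s by move=> h1 h2; split; rewrite ?lte_fin.
have ct (V : normedModType K) (f : K -> V) t d : 0 < t ->
    has_deriv_within (time_dom 0 +oo%E) f t d -> {for t, continuous f}.
  move=> t_gt0 /has_deriv_within_continuous; apply: cvg_trans => A.
  rewrite /within /= => h.
  have hpos : nbhs t [set s | 0 <= s].
    apply/nbhs_ballP; exists t => // s; rewrite -ball_normE /= ltr_norml; lra.
  by apply: (@filterS2 _ (nbhs t) _ _ _ _ _ h hpos) => s hs s_ge0; apply: hs; exact: domP.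
pose M := 2 / Num.sqrt Jm * (Num.sqrt JM + Num.sqrt Jm) * error_norm (y t0).
have [|||T' TT' [y' y'E y'd]] := @solution_extension K (obs_state K)
  (@compact_closed_ball_obs_state K) G s0 T M y s0T.
- move=> t /andP[st tT]; apply: has_deriv_within_subset (yd sol t (dom _ _ _)) => //.
    by move=> v /= /andP[sv vT]; apply: dom => //; lra.
  lra.
- move=> t /andP[st tT]; apply: le_trans (normr_le_error_norm _) _.
  have tt : t0 <= t by lra.
  apply: le_trans (decay sol t (dom _ tt tT)) _.
  rewrite /M -[leRHS]mulr1 ler_wpM2l //.
    by rewrite mulr_ge0 ?error_norm_ge0 // ltW.
  by rewrite -expR0 ler_expR mulNr oppr_le0 mulr_ge0 ?subr_ge0 // ltW.
- move=> t v st; have t_gt0 : 0 < t by lra.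
  have [dw wdt _] := wd t (ltW t_gt0).
  have r1c := ct _ _ _ _ t_gt0 (r1d t (ltW t_gt0)).
  have r2c := ct _ _ _ _ t_gt0 (r2d t (ltW t_gt0)).
  have wc := ct _ _ _ _ t_gt0 wdt.
  exact: (@error_field_continuous K J k1 k2 l1 l2 l1_cont l2_cont r1 r2 omega t v r1c r2c wc).
pose x' s := state_of_error J k1 k2 (r1 s) (r2 s) (omega s) (y' s).
have x'x s : s < T -> x' s = x s.
  by move=> sT; rewrite /x' y'E // error_stateK.
have sol' : solution F t0 T'%:E x'.
  split; first by rewrite lte_fin; lra.
  move=> t [t0t]; rewrite lte_fin => tT'.
  (* Before [T] the curve is the given solution, which also covers the times before [s0]. From [T]
     on it comes from [y'], and the radius [t - s0] keeps clear of times before [s0]. *)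
  have [tT|Tt] := ltP t T.
    rewrite x'x //.
    apply: (@has_deriv_within_local _ _ _ (time_dom t0 T%:E) x _ _ _ (T - t)).
    - by rewrite subr_gt0.
    - move=> s [t0s _]; rewrite ltr_norml => /andP[_]; rewrite ltrD2r => sT.
      by split; [exact: dom | rewrite x'x].
    - by rewrite x'x.
    - by case: sol => _; apply; exact: dom.
  have tge0 : 0 <= t by lra.
  have [dw wdt Jdw] := wd t tge0.
  have sub : time_dom t0 T'%:E `<=` time_dom 0 +oo%E.
    by move=> s [t0s _]; apply: domP; exact: le_trans t0s.
  apply: (has_deriv_within_state_of_error J_sym Jm_gt0 J_ge _ _ _ Jdw).
  - exact: has_deriv_within_subset sub (r1d t tge0).
  - exact: has_deriv_within_subset sub (r2d t tge0).
  - exact: has_deriv_within_subset sub wdt.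
  apply: (@has_deriv_within_local _ _ _ [set s | s0 <= s < T'] y' _ _ _ (t - s0)).
  - lra.
  - move=> s [t0s]; rewrite lte_fin ltr_norml => sT' /andP[h _]; split=> //=.
    by rewrite sT' andbT; lra.
  - by [].
  - by apply: y'd; rewrite tT' andbT; lra.
have := maxi T'%:E x' sol'.
rewrite lee_fin ltW // => /(_ isT) H.
have : T'%:E = T%:E by apply: H => t [_]; rewrite lte_fin; exact: x'x.
by case=> E; move: TT'; rewrite E ltxx.
Qed.
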